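(* Let $\mathbb{K}$ be an algebraically closed field, let $A, R$ be finite-dimensional $\mathbb{K}$-algebras, let $\xi:R\to A$ be a split extension of $A$ by the nilpotent $(A,A)$-bimodule $Q$, and let $M_1,M_2,\ldots,M_r$ be right $A$-modules in $\mathrm{mod}(A)$. If (1) $(M_1,M_2,\ldots,M_r)$ is an exceptional sequence; (2) $\xi$ is projective, i.e. ${}_AR$ is a projective left $A$-module; (3) $\mathrm{Hom}_A(M_k,M_k\otimes_A Q)=0$ for all $1\leq k\leq r$ and $\mathrm{Hom}_A(M_j,M_i\otimes_A Q)=0$ for all $1\leq i<j\leq r$; (4) $\mathrm{Ext}^n_A(M_k,M_k\otimes_A Q)=0$ for all $1\leq k\leq r$ and $\mathrm{Ext}^n_A(M_j,M_i\otimes_A Q)=0$ for all $1\leq i<j\leq r$, for every positive integer $n$, then $(M_1\otimes_A R, M_2\otimes_A R,\ldots,M_r\otimes_A R)$ is an exceptional sequence in $\mathrm{mod}(R)$. In addition, if $(M_1,M_2,\ldots,M_r)$ is complete, then so is $(M_1\otimes_A R,M_2\otimes_A R,\ldots,M_r\otimes_A R)$.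
   Context: For a finite-dimensional $\mathbb{K}$-algebra $B$, $\mathrm{mod}(B)$ is the category of finitely generated right $B$-modules. Exceptional sequences: an indecomposable $B$-module $M$ is exceptional if $\mathrm{End}_B(M)\cong\mathbb{K}$ and $\mathrm{Ext}^n_B(M,M)=0$ for every positive integer $n$. A pair $(M_i,M_j)$ of exceptional modules is an exceptional pair if $\mathrm{Hom}_B(M_j,M_i)=0$ and $\mathrm{Ext}^n_B(M_j,M_i)=0$ for every positive integer $n$. A sequence $(M_1,\ldots,M_r)$ of exceptional modules is an exceptional sequence if $(M_i,M_j)$ is an exceptional pair for all $1\leq i<j\leq r$. An exceptional sequence $(M_1,\ldots,M_r)$ in $\mathrm{mod}(B)$ is complete if $r$ equals the rank of the Grothendieck group $K(B)$ of $\mathrm{mod}(B)$. Split extensions: $R$ is a split extension of $A$ by the nilpotent bimodule $Q$ if $\xi:R\to A$ is a split surjective algebra morphism (i.e. it has a right inverse algebra morphism $A\to R$, which makes $R$ an $(A,A)$-bimodule) whose kernel $Q:=\mathrm{Ker}(\xi)$ is contained in the radical $\mathrm{rad}\,R$. Then ${}_AR_A\cong A\oplus{}_AQ_A$, and $-\otimes_A R:\mathrm{mod}(A)\to\mathrm{mod}(R)$. *)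

(* Defs.v *)
From HB Require Import structures.
From mathcomp Require Import all_boot all_order all_algebra.
From mathcomp Require Import falgebra ring_quotient.
From mathcomp Require Import boolp.
From mathcomp Require Import freeg.

Set Implicit Arguments.
Unset Strict Implicit.
Unset Printing Implicit Defensive.

Import GRing.Theory.
Local Open Scope ring_scope.

(* Over a finite-dimensional algebra, finitely generated modules are the
   modules of finite dimension over the ground field, hence the vectType
   carriers. *)
Record rmod (K : fieldType) (B : falgType K) := RMod {
  rm_space :> vectType K;
  ract : rm_space -> B -> rm_space;
  ract_linl : forall b, linear (ract^~ b);
  ract_linr : forall m, linear (ract m);
  ract1 : forall m, ract m 1 = m;
  ractM : forall m a b, ract m (a * b) = ract (ract m a) b }.

Record lmod (K : fieldType) (B : falgType K) := LMod {
  lm_space :> vectType K;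
  lact : B -> lm_space -> lm_space;
  lact_linl : forall m, linear (lact^~ m);
  lact_linr : forall b, linear (lact b);
  lact1 : forall m, lact 1 m = m;
  lactM : forall a b m, lact (a * b) m = lact a (lact b m) }.

Record bimod (K : fieldType) (A B : falgType K) := BiMod {
  bm_left :> lmod A;
  bract : bm_left -> B -> bm_left;
  bract_linl : forall b, linear (bract^~ b);
  bract_linr : forall m, linear (bract m);
  bract1 : forall m, bract m 1 = m;
  bractM : forall m a b, bract m (a * b) = bract (bract m a) b;
  bm_assoc : forall a m b, bract (lact a m) b = lact a (bract m b) }.

Section LinearMaps.
Variable K : fieldType.

Definition llinfun (U V : vectType K) (f : U -> V) (lf : linear f) :
    'Hom(U, V) :=
  let F : {linear U -> V} :=
    HB.pack f (GRing.isSemilinear.Build K U V *:%R f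
                 (GRing.semilinear_linear lf)) in
  linfun F.

Lemma llinfunE (U V : vectType K) (f : U -> V) (lf : linear f) u :
  llinfun lf u = f u.
Proof. by rewrite /llinfun lfunE. Qed.

Section LinearFacts.
Variables (U V : vectType K) (f : U -> V) (lf : linear f).

Lemma lin_0 : f 0 = 0. Proof. by rewrite -(llinfunE lf) linear0. Qed.
Lemma lin_B u v : f (u - v) = f u - f v.
Proof. by rewrite -!(llinfunE lf) linearB. Qed.
Lemma lin_Z a u : f (a *: u) = a *: f u.
Proof. by rewrite -!(llinfunE lf) linearZ. Qed.
Lemma lin_sum I (r : seq I) (P : pred I) (F : I -> U) :
  f (\sum_(i <- r | P i) F i) = \sum_(i <- r | P i) f (F i).
Proof.
rewrite -(llinfunE lf) linear_sum.
by apply: eq_bigr => i _; rewrite -(llinfunE lf).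
Qed.

End LinearFacts.

Lemma vsval_lin (V : vectType K) (U : {vspace V}) a (u v : subvs_of U) :
  vsval (a *: u + v) = a *: vsval u + vsval v.
Proof. exact: linearP. Qed.

Lemma vsval_inj (V : vectType K) (U : {vspace V}) : injective (@vsval K V U).
Proof. exact: val_inj. Qed.

Fact precomp_linear (U V W : vectType K) (d : 'Hom(U, V)) :
  linear (fun f : 'Hom(V, W) => (f \o d)%VF).
Proof. by move=> a f g; apply/lfunP=> u; rewrite !(comp_lfunE, add_lfunE, scale_lfunE). Qed.

Definition precomp (U V W : vectType K) (d : 'Hom(U, V)) :
    'Hom('Hom(V, W), 'Hom(U, W)) :=
  llinfun (precomp_linear (W := W) d).

Lemma precompE (U V W : vectType K) (d : 'Hom(U, V)) (f : 'Hom(V, W)) :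
  precomp W d f = (f \o d)%VF.
Proof. exact: llinfunE. Qed.

End LinearMaps.

Section Quotient.
Variables (K : fieldType) (V : vectType K) (U : {vspace V}).

(* The quotient V / U is realised on a complement of U. *)
Definition quotv : vectType K := subvs_of (U^C)%VS.
Definition quot_proj : 'Hom(V, quotv) :=
  (linfun (vsproj (U^C)%VS) \o daddv_pi (U^C)%VS U)%VF.

Fact capCv : ((U^C) :&: U = 0)%VS. Proof. by rewrite capvC capv_compl. Qed.

Lemma vsval_quot_proj v : vsval (quot_proj v) = daddv_pi (U^C)%VS U v.
Proof. by rewrite lfunE /= lfunE /= vsprojK // memv_pi. Qed.

Lemma quot_proj_eq0 v : (quot_proj v == 0) = (v \in U).
Proof.
rewrite -(inj_eq val_inj) /= vsval_quot_proj.
have vE : daddv_pi (U^C)%VS U v + daddv_pi U (U^C)%VS v = v.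
  by apply: daddv_pi_add; rewrite ?capCv // addvC addv_complf memvf.
apply/eqP/idP => [v0|Uv].
  by rewrite -vE v0 add0r memv_pi.
by apply: (addIr v); rewrite add0r -[RHS]vE (daddv_pi_id (capv_compl U) Uv).
Qed.

Lemma quot_projK w : quot_proj (vsval w) = w.
Proof.
apply: val_inj; rewrite /= vsval_quot_proj.
by rewrite daddv_pi_id ?capCv // subvsP.
Qed.

End Quotient.

Section Modules.
Variables (K : fieldType) (B : falgType K).
Implicit Types (M N L : rmod B).

Definition is_hom M N (f : 'Hom(M, N)) : Prop :=
  forall m b, f (ract m b) = ract (f m) b.

Fact hom_defect_linear1 M N b (f : 'Hom(M, N)) :
  linear (fun m => f (ract m b) - ract (f m) b).
Proof.
move=> a u v; rewrite ract_linl !linearP ract_linl scalerBr.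
by rewrite opprD addrACA.
Qed.

Fact hom_defect_linear2 M N b :
  linear (fun f : 'Hom(M, N) => llinfun (hom_defect_linear1 b f)).
Proof.
move=> a f g; apply/lfunP=> u.
rewrite llinfunE !(add_lfunE, scale_lfunE) !llinfunE.
by rewrite ract_linl scalerBr opprD addrACA.
Qed.

(* The space Hom_B(M, N) of module homomorphisms, see mem_homB. *)
Definition homB M N : {vspace 'Hom(M, N)} :=
  (\bigcap_(i < \dim {:B})
     lker (llinfun (hom_defect_linear2 (M:=M) (N:=N) (vbasis {:B})`_i)))%VS.

Lemma mem_homB M N (f : 'Hom(M, N)) : f \in homB M N <-> is_hom f.
Proof.
split=> [fH m b|fH]; last first.
  apply/subv_bigcapP => i _; rewrite -memvE memv_ker llinfunE.
  apply/eqP/lfunP=> m.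
  by rewrite llinfunE lfunE /= fH subrr.
have {fH} fb (i : 'I_(\dim {:B})) u :
    f (ract u (vbasis {:B})`_i) = ract (f u) (vbasis {:B})`_i.
  have /subv_bigcapP/(_ i isT) := fH.
  rewrite -memvE memv_ker llinfunE => /eqP/lfunP/(_ u).
  by rewrite llinfunE lfunE /= => /eqP; rewrite subr_eq0 => /eqP.
rewrite (coord_vbasis (memvf b)).
rewrite !(lin_sum (ract_linr _)) linear_sum; apply: eq_bigr => i _.
by rewrite !(lin_Z (ract_linr _)) linearZ /= fb.
Qed.

Definition projective M : Prop :=
  forall (X Y : rmod B) (g : 'Hom(X, Y)) (f : 'Hom(M, Y)),
    is_hom g -> limg g = fullv -> is_hom f ->
    exists h : 'Hom(M, X), is_hom h /\ (g \o h)%VF = f.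

Definition ses L M N : Prop :=
  exists (f : 'Hom(L, M)) (g : 'Hom(M, N)),
    [/\ is_hom f, is_hom g, lker f = 0%VS, limg f = lker g & limg g = fullv].

Record projres M := ProjRes {
  pr_mod :> nat -> rmod B;
  pr_d : forall n, 'Hom(pr_mod n.+1, pr_mod n);
  pr_aug : 'Hom(pr_mod 0, M);
  pr_proj : forall n, projective (pr_mod n);
  pr_d_hom : forall n, is_hom (pr_d n);
  pr_aug_hom : is_hom pr_aug;
  pr_aug_surj : limg pr_aug = fullv;
  pr_exact0 : lker pr_aug = limg (pr_d 0);
  pr_exactS : forall n, lker (pr_d n) = limg (pr_d n.+1) }.

Section ExtOf.
Variables (M N : rmod B) (P : projres M).

Definition cocycles (n : nat) : {vspace 'Hom(P n, N)} :=
  (homB (P n) N :&: lker (precomp N (pr_d P n)))%VS.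

Definition coboundaries (n : nat) : {vspace 'Hom(P n, N)} :=
  if n is m.+1 then (precomp N (pr_d P m) @: homB (P m) N)%VS else 0%VS.

(* H^n(Hom_B(P, N)), the quotient of cocycles by coboundaries being realised
   on a complement of the coboundaries in the cocycles. *)
Definition ext_of (n : nat) : {vspace 'Hom(P n, N)} :=
  (cocycles n :\: coboundaries n)%VS.

End ExtOf.

Section FreeModule.
Variable n : nat.

Definition free_act (f : {ffun 'I_n -> B}) (b : B) : {ffun 'I_n -> B} :=
  [ffun i => f i * b].

Fact free_act_linl b : linear (free_act^~ b).
Proof.
by move=> a f g; apply/ffunP=> i; rewrite !ffunE mulrDl -scalerAl.
Qed.
Fact free_act_linr f : linear (free_act f).
Proof.
by move=> a b c; apply/ffunP=> i; rewrite !ffunE mulrDr -scalerAr.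
Qed.
Fact free_act1 f : free_act f 1 = f.
Proof. by apply/ffunP=> i; rewrite !ffunE mulr1. Qed.
Fact free_actM f a b : free_act f (a * b) = free_act (free_act f a) b.
Proof. by apply/ffunP=> i; rewrite !ffunE mulrA. Qed.

Definition free_rmod : rmod B :=
  RMod free_act_linl free_act_linr free_act1 free_actM.

Section FreeMap.
Variables (M : rmod B) (e : 'I_n -> M).

Fact free_map_linear : linear (fun f : free_rmod => \sum_i ract (e i) (f i)).
Proof.
move=> a f g; rewrite scaler_sumr -big_split; apply: eq_bigr => i _ /=.
by rewrite !ffunE ract_linr.
Qed.
Definition free_map : 'Hom(free_rmod, M) := llinfun free_map_linear.

Lemma free_mapE f : free_map f = \sum_i ract (e i) (f i).
Proof. exact: llinfunE. Qed.

Lemma free_map_hom : is_hom free_map.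
Proof.
move=> f b; rewrite !free_mapE.
rewrite (lin_sum (ract_linl b)); apply: eq_bigr => i _.
by rewrite ffunE ractM.
Qed.

Definition free_gen (i : 'I_n) : free_rmod := [ffun j => (i == j)%:R : B].

Lemma free_map_gen i : free_map (free_gen i) = e i.
Proof.
rewrite free_mapE (bigD1 i) //= ffunE eqxx ract1 big1 ?addr0 // => j ji.
by rewrite ffunE eq_sym (negPf ji) (lin_0 (ract_linr _)).
Qed.

End FreeMap.

Lemma free_hom_eq (M : rmod B) (f g : 'Hom(free_rmod, M)) :
  is_hom f -> is_hom g -> (forall i, f (free_gen i) = g (free_gen i)) -> f = g.
Proof.
move=> fH gH fg; apply/lfunP=> u.
have -> : u = \sum_i ract (free_gen i) (u i).
  apply/ffunP=> j; rewrite sum_ffunE (bigD1 j) //= !ffunE eqxx mul1r.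
  by rewrite big1 ?addr0 // => i ij; rewrite !ffunE (negPf ij) mul0r.
by rewrite !linear_sum; apply: eq_bigr => i _; rewrite /= fH gH fg.
Qed.

Lemma free_projective : projective free_rmod.
Proof.
move=> X Y g f gH gS fH.
have gX i : f (free_gen i) \in limg g by rewrite gS memvf.
pose e i : X := (g^-1)%VF (f (free_gen i)).
exists (free_map e); split; first exact: free_map_hom.
apply: free_hom_eq => // [u b|i].
  by rewrite !lfunE /= free_map_hom gH.
by rewrite lfunE /= free_map_gen /e limg_lfunVK.
Qed.

End FreeModule.

Section Cover.
Variable M : rmod B.

Definition cover : rmod B := free_rmod (\dim {:M}).
Definition cover_map : 'Hom(cover, M) :=
  free_map (fun i : 'I_(\dim {:M}) => (vbasis {:M})`_i).

Lemma cover_hom : is_hom cover_map. Proof. exact: free_map_hom. Qed.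

Lemma cover_surj : limg cover_map = fullv.
Proof.
apply/eqP; rewrite eqEsubv subvf /= -{1}(span_basis (vbasisP {:M})).
apply/span_subvP=> v /(nthP 0)[i]; rewrite size_tuple => ltiM <-.
have <- := free_map_gen (fun i : 'I_(\dim {:M}) => (vbasis {:M})`_i)
             (Ordinal ltiM).
exact: memv_img (memvf _).
Qed.

End Cover.

Section Kernel.
Variables (M N : rmod B) (f : 'Hom(M, N)) (fH : is_hom f).

Definition ker_act (u : subvs_of (lker f)) (b : B) : subvs_of (lker f) :=
  vsproj (lker f) (ract (vsval u) b).

Fact vsval_ker_act u b : vsval (ker_act u b) = ract (vsval u) b.
Proof.
rewrite vsprojK // memv_ker fH.
have /eqP-> : f (vsval u) == 0 by rewrite -memv_ker subvsP.
by rewrite (lin_0 (ract_linl b)).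
Qed.
Fact ker_act_linl b : linear (ker_act^~ b).
Proof.
move=> a u v; apply: vsval_inj.
by rewrite [RHS]vsval_lin !vsval_ker_act vsval_lin ract_linl.
Qed.
Fact ker_act_linr u : linear (ker_act u).
Proof.
move=> a b c; apply: vsval_inj.
by rewrite [RHS]vsval_lin !vsval_ker_act ract_linr.
Qed.
Fact ker_act1 u : ker_act u 1 = u.
Proof. by apply: vsval_inj; rewrite vsval_ker_act ract1. Qed.
Fact ker_actM u a b : ker_act u (a * b) = ker_act (ker_act u a) b.
Proof. by apply: vsval_inj; rewrite !vsval_ker_act ractM. Qed.

Definition ker_rmod : rmod B :=
  RMod ker_act_linl ker_act_linr ker_act1 ker_actM.
Definition ker_incl : 'Hom(ker_rmod, M) := linfun vsval.

Lemma ker_incl_hom : is_hom ker_incl.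
Proof. by move=> u b; rewrite !lfunE /= vsval_ker_act. Qed.

Lemma ker_incl_inj : lker ker_incl = 0%VS.
Proof.
by apply/eqP/lker0P=> u v; rewrite !lfunE; apply: val_inj.
Qed.

Lemma ker_incl_img : limg ker_incl = lker f.
Proof.
apply/vspaceP=> v; apply/memv_imgP/idP => [[u _ ->]|fv].
  by rewrite lfunE subvsP.
by exists (vsproj (lker f) v); rewrite ?memvf // lfunE /= vsprojK.
Qed.

End Kernel.

Section StandardResolution.
Variable M : rmod B.

Definition syzygy (L : rmod B) : rmod B := ker_rmod (@cover_hom L).

Definition std_mod (n : nat) : rmod B := cover (iter n syzygy M).
Definition std_d (n : nat) : 'Hom(std_mod n.+1, std_mod n) :=
  (ker_incl (@cover_hom (iter n syzygy M))
     \o cover_map (iter n.+1 syzygy M))%VF.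

Fact std_d_hom n : is_hom (std_d n).
Proof.
by move=> u b; rewrite /std_d !comp_lfunE cover_hom ker_incl_hom.
Qed.

Fact std_d_img n : limg (std_d n) = lker (cover_map (iter n syzygy M)).
Proof. by rewrite /std_d limg_comp cover_surj ker_incl_img. Qed.

Fact std_d_ker n : lker (std_d n) = limg (std_d n.+1).
Proof.
rewrite std_d_img; apply/vspaceP=> u; rewrite !memv_ker comp_lfunE.
have /eqP/lker0P inj := ker_incl_inj (@cover_hom (iter n syzygy M)).
by rewrite -[X in _ == X](linear0 (ker_incl (@cover_hom (iter n syzygy M))))
  (inj_eq inj).
Qed.

Definition std_res : projres M :=
  ProjRes (fun n => @free_projective (\dim {: iter n syzygy M})) std_d_hom
    (@cover_hom M) (cover_surj M) (esym (std_d_img 0)) std_d_ker.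

End StandardResolution.

(* Ext is computed on the free resolution whose n-th term is the module
   B ^ (dim S) over the n-th syzygy S; std_res packs the proof that it is a
   projective resolution. *)
Definition Ext (n : nat) M N : {vspace 'Hom(std_res M n, N)} :=
  ext_of N (std_res M) n.

Definition stable M (U : {vspace M}) : Prop :=
  forall u b, u \in U -> ract u b \in U.

Definition indecomposable M : Prop :=
  ({:M} != 0)%VS /\
  forall U V : {vspace M}, stable U -> stable V ->
    (U + V = fullv)%VS -> (U :&: V = 0)%VS -> U = 0%VS \/ V = 0%VS.

(* phi corestricts to an isomorphism of K-algebras from K to End_B(M), the
   product of the latter being the composition. *)
Definition end_iso_K M : Prop :=
  exists phi : {linear K^o -> 'End(M)},
    [/\ phi 1 = \1%VF, forall a b : K, phi (a * b) = (phi a \o phi b)%VF,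
        injective phi &
        forall f : 'End(M), f \in homB M M <-> exists a : K, f = phi a].

Definition exceptional M : Prop :=
  [/\ indecomposable M, end_iso_K M & forall n, (0 < n)%N -> Ext n M M = 0%VS].

Definition exceptional_pair M N : Prop :=
  [/\ exceptional M, exceptional N, homB N M = 0%VS &
      forall n, (0 < n)%N -> Ext n N M = 0%VS].

Definition exceptional_seq r (M : 'I_r -> rmod B) : Prop :=
  (forall i, exceptional (M i)) /\
  (forall i j : 'I_r, (i < j)%N -> exceptional_pair (M i) (M j)).

(* The collection of all right modules is too large to carry a choiceType
   structure.  As every finite-dimensional module is isomorphic to one carried
   by row vectors (see rv_rmod_iso), the Grothendieck group is generated by the
   latter; isomorphic modules get identified in it by the relations coming from
   the exact sequences 0 -> M -> N -> 0 -> 0. *)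
Record rvmod := RVMod {
  rv_dim : nat;
  rv_act : 'rV[K]_rv_dim -> B -> 'rV[K]_rv_dim;
  rv_act_linl : forall b, linear (rv_act^~ b);
  rv_act_linr : forall m, linear (rv_act m);
  rv_act1 : forall m, rv_act m 1 = m;
  rv_actM : forall m a b, rv_act m (a * b) = rv_act (rv_act m a) b }.

Definition rv_rmod (M : rvmod) : rmod B :=
  RMod (@rv_act_linl M) (@rv_act_linr M) (@rv_act1 M) (@rv_actM M).

Lemma rv_rmod_iso M : exists (N : rvmod) (f : 'Hom(M, rv_rmod N)),
  [/\ is_hom f, lker f = 0%VS & limg f = fullv].
Proof.
pose n := \dim {:M}; pose e : n.-tuple M := vbasis {:M}.
pose vec (u : 'rV[K]_n) : M := \sum_i u 0 i *: e`_i.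
pose crd (m : M) : 'rV[K]_n := \row_i coord e i m.
have vecK u : crd (vec u) = u.
  apply/rowP=> i; rewrite mxE coord_sum_free //.
  exact: basis_free (vbasisP _).
have crdK m : vec (crd m) = m.
  rewrite {2}(coord_vbasis (memvf m)); apply: eq_bigr => i _.
  by rewrite mxE.
have crd_lin : linear crd.
  by move=> a u v; apply/rowP=> i; rewrite !mxE linearP.
have vec_lin : linear vec.
  move=> a u v; rewrite scaler_sumr -big_split; apply: eq_bigr => i _ /=.
  by rewrite !mxE scalerDl scalerA.
pose act u b := crd (ract (vec u) b).
have act_linl b : linear (act^~ b).
  by move=> a u v; rewrite /act vec_lin ract_linl crd_lin.
have act_linr u : linear (act u).
  by move=> a b c; rewrite /act ract_linr crd_lin.
have act1 u : act u 1 = u by rewrite /act ract1 vecK.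
have actM u a b : act u (a * b) = act (act u a) b.
  by rewrite /act crdK ractM.
exists (RVMod act_linl act_linr act1 actM), (llinfun crd_lin); split.
- by move=> m b; rewrite !llinfunE /= /act crdK.
- apply/eqP/lker0P=> u v; rewrite !llinfunE => uv.
  by rewrite -(crdK u) uv crdK.
- apply/vspaceP=> u; rewrite memvf; apply/memv_imgP; exists (vec u).
    exact: memvf.
  by rewrite llinfunE vecK.
Qed.

Local Notation free := {freeg {classic rvmod} / int}.

Inductive k0_rel : free -> Prop :=
  | k0_rel0 : k0_rel 0
  | k0_relB x y of k0_rel x & k0_rel y : k0_rel (x - y)
  | k0_rel_ses (L M N : {classic rvmod}) of
      ses (rv_rmod L) (rv_rmod M) (rv_rmod N) :
      k0_rel (<< M >> - << L >> - << N >>).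

Definition k0_pred : {pred free} := fun x => `[< k0_rel x >].

Fact k0_zmod_closed : zmod_closed k0_pred.
Proof.
split=> [|x y /asboolP xr /asboolP yr]; first exact/asboolP/k0_rel0.
exact/asboolP/k0_relB.
Qed.
HB.instance Definition _ := GRing.isZmodClosed.Build free k0_pred k0_zmod_closed.

Definition K0 : zmodType := {ideal_quot k0_pred}.

End Modules.

Definition zindep (G : zmodType) (r : nat) (x : 'I_r -> G) : Prop :=
  forall c : 'I_r -> int, \sum_i x i *~ c i = 0 -> forall i, c i = 0.

Definition has_rank (G : zmodType) (r : nat) : Prop :=
  (exists x : 'I_r -> G, zindep x) /\ ~ exists x : 'I_r.+1 -> G, zindep x.

Definition complete_exceptional_seq (K : fieldType) (B : falgType K)
    (r : nat) (M : 'I_r -> rmod B) : Prop :=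
  exceptional_seq M /\ has_rank (K0 B) r.

Section LeftModules.
Variables (K : fieldType) (A : falgType K).

Definition is_lhom (M N : lmod A) (f : 'Hom(M, N)) : Prop :=
  forall a m, f (lact a m) = lact a (f m).

Definition lprojective (M : lmod A) : Prop :=
  forall (X Y : lmod A) (g : 'Hom(X, Y)) (f : 'Hom(M, Y)),
    is_lhom g -> limg g = fullv -> is_lhom f ->
    exists h : 'Hom(M, X), is_lhom h /\ (g \o h)%VF = f.

End LeftModules.

Section Tensor.
Variables (K : fieldType) (A B : falgType K) (M : rmod A) (X : bimod A B).

(* M (x)_K X is realised as X ^ (dim M) through the basis vbasis {:M} of M. *)
Definition tensK : vectType K := {ffun 'I_(\dim {:M}) -> X}.
Definition pureK (m : M) (x : X) : tensK :=
  [ffun i => coord (vbasis {:M}) i m *: x].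

Fact pureK_linl x : linear (pureK^~ x).
Proof.
by move=> a u v; apply/ffunP=> i; rewrite !ffunE linearP scalerDl scalerA.
Qed.
Fact pureK_linr m : linear (pureK m).
Proof.
move=> a u v; apply/ffunP=> i; rewrite !ffunE scalerDr !scalerA.
by rewrite (mulrC a).
Qed.

Fact tens_defect_linear (m : M) (a : A) :
  linear (fun x : X => pureK (ract m a) x - pureK m (lact a x)).
Proof.
move=> c u v; rewrite lact_linr !pureK_linr scalerBr.
by rewrite opprD addrACA.
Qed.

(* The span of all (m a) (x) x - m (x) (a x), see mem_tens_rel and
   tens_rel_sub. *)
Definition tens_rel : {vspace tensK} :=
  (\sum_(i < \dim {:M}) \sum_(j < \dim {:A})
     limg (llinfun (tens_defect_linear (vbasis {:M})`_i (vbasis {:A})`_j)))%VS.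

Lemma mem_tens_rel m a x : pureK (ract m a) x - pureK m (lact a x) \in tens_rel.
Proof.
have E : pureK (ract m a) x - pureK m (lact a x) =
  \sum_i \sum_j (coord (vbasis {:M}) i m * coord (vbasis {:A}) j a) *:
    (pureK (ract (vbasis {:M})`_i (vbasis {:A})`_j) x
      - pureK (vbasis {:M})`_i (lact (vbasis {:A})`_j x)).
  rewrite {1 2}(coord_vbasis (memvf m)) (lin_sum (ract_linl a)).
  rewrite !(lin_sum (pureK_linl _)) -sumrB; apply: eq_bigr => i _.
  rewrite (lin_Z (ract_linl a)) !(lin_Z (pureK_linl _)) -scalerBr.
  rewrite {1 2}(coord_vbasis (memvf a)) (lin_sum (ract_linr _)).
  rewrite (lin_sum (lact_linl _)) (lin_sum (pureK_linl _)).
  rewrite (lin_sum (pureK_linr _)) -sumrB scaler_sumr.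
  apply: eq_bigr => j _; rewrite (lin_Z (ract_linr _)) (lin_Z (lact_linl _)).
  by rewrite (lin_Z (pureK_linl _)) (lin_Z (pureK_linr _)) -scalerBr scalerA.
rewrite {}E; apply: memv_suml => i _; apply: memv_suml => j _; apply: memvZ.
apply: (subvP (sumv_sup i _ (sumv_sup j _ (subvv _)))) => //.
apply/memv_imgP; exists x; first exact: memvf.
by rewrite llinfunE.
Qed.

Lemma tens_rel_sub (W : {vspace tensK}) :
  (forall m a x, pureK (ract m a) x - pureK m (lact a x) \in W) ->
  (tens_rel <= W)%VS.
Proof.
move=> sW; apply/subv_sumP=> i _; apply/subv_sumP=> j _; apply/subvP=> u.
by case/memv_imgP=> x _ ->; rewrite llinfunE.
Qed.

Definition tensK_act (t : tensK) (b : B) : tensK := [ffun i => bract (t i) b].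

Fact tensK_act_linl b : linear (tensK_act^~ b).
Proof. by move=> a f g; apply/ffunP=> i; rewrite !ffunE bract_linl. Qed.
Fact tensK_act_linr t : linear (tensK_act t).
Proof. by move=> a b c; apply/ffunP=> i; rewrite !ffunE bract_linr. Qed.

Fact tensK_act_pure m x b : tensK_act (pureK m x) b = pureK m (bract x b).
Proof. by apply/ffunP=> i; rewrite !ffunE (lin_Z (bract_linl b)). Qed.

Fact tensK_act_rel t b : t \in tens_rel -> tensK_act t b \in tens_rel.
Proof.
move/(subvP (tens_rel_sub _)).
move/(_ (llinfun (tensK_act_linl b) @^-1: tens_rel)%VS).
rewrite -memv_preim llinfunE; apply=> m a x.
rewrite -memv_preim llinfunE (lin_B (tensK_act_linl b)) !tensK_act_pure bm_assoc.
exact: mem_tens_rel.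
Qed.

Definition tens_space : vectType K := quotv tens_rel.
Definition tens_act (u : tens_space) (b : B) : tens_space :=
  quot_proj tens_rel (tensK_act (vsval u) b).

Fact tens_act_proj t b :
  tens_act (quot_proj tens_rel t) b = quot_proj tens_rel (tensK_act t b).
Proof.
apply/eqP; rewrite /tens_act -subr_eq0 -linearB quot_proj_eq0.
rewrite -(lin_B (tensK_act_linl b)) tensK_act_rel //.
by rewrite -quot_proj_eq0 linearB /= quot_projK subrr.
Qed.

Fact tens_act_linl b : linear (tens_act^~ b).
Proof.
by move=> a u v; rewrite /tens_act vsval_lin tensK_act_linl linearP.
Qed.
Fact tens_act_linr u : linear (tens_act u).
Proof. by move=> a b c; rewrite /tens_act tensK_act_linr linearP. Qed.
Fact tens_act1 u : tens_act u 1 = u.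
Proof.
rewrite -[u]quot_projK tens_act_proj; congr (quot_proj _ _).
by apply/ffunP=> i; rewrite ffunE bract1.
Qed.
Fact tens_actM u a b : tens_act u (a * b) = tens_act (tens_act u a) b.
Proof.
rewrite -[u]quot_projK !tens_act_proj; congr (quot_proj _ _).
by apply/ffunP=> i; rewrite !ffunE bractM.
Qed.

Definition tensor : rmod B :=
  RMod tens_act_linl tens_act_linr tens_act1 tens_actM.

Definition pure (m : M) (x : X) : tensor := quot_proj tens_rel (pureK m x).

Lemma pure_linl x : linear (pure^~ x).
Proof. by move=> a u v; rewrite /pure pureK_linl linearP. Qed.
Lemma pure_linr m : linear (pure m).
Proof. by move=> a u v; rewrite /pure pureK_linr linearP. Qed.
Lemma pure_balanced m a x : pure (ract m a) x = pure m (lact a x).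
Proof.
by apply/eqP; rewrite -subr_eq0 -linearB quot_proj_eq0 mem_tens_rel.
Qed.
Lemma pure_act m x b : ract (pure m x) b = pure m (bract x b).
Proof. by rewrite /= tens_act_proj tensK_act_pure. Qed.

Lemma tensor_gen (t : tensor) :
  exists x : 'I_(\dim {:M}) -> X, t = \sum_(i < \dim {:M}) pure (vbasis {:M})`_i (x i).
Proof.
exists (vsval t); rewrite -[LHS]quot_projK -linear_sum; congr (quot_proj _ _).
apply/ffunP=> i; rewrite sum_ffunE (bigD1 i) //= big1 ?addr0 => [|j ji].
  by rewrite ffunE coord_free ?eqxx ?scale1r // (basis_free (vbasisP _)).
by rewrite ffunE coord_free ?(negPf ji) ?scale0r // (basis_free (vbasisP _)).
Qed.

Lemma tensor_univ (V : vectType K) (f : M -> X -> V) :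
  (forall x, linear (f^~ x)) -> (forall m, linear (f m)) ->
  (forall m a x, f (ract m a) x = f m (lact a x)) ->
  exists! F : 'Hom(tensor, V), forall m x, F (pure m x) = f m x.
Proof.
move=> fl fr fb.
pose G0 (t : tensK) := \sum_(i < \dim {:M}) f (vbasis {:M})`_i (t i).
have G0l : linear G0.
  move=> a u v; rewrite scaler_sumr -big_split; apply: eq_bigr => i _ /=.
  by rewrite !ffunE fr.
have G0p m x : G0 (pureK m x) = f m x.
  rewrite [in RHS](coord_vbasis (memvf m)) (lin_sum (fl x)).
  apply: eq_bigr => i _; rewrite ffunE.
  by rewrite (lin_Z (fr _)) (lin_Z (fl _)).
have G0r t : t \in tens_rel -> G0 t = 0.
  have /subvP sub : (tens_rel <= lker (llinfun G0l))%VS.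
    apply: tens_rel_sub => m a x.
    by rewrite memv_ker llinfunE (lin_B G0l) !G0p fb subrr.
  by move/sub; rewrite memv_ker llinfunE => /eqP.
have Fl : linear (fun t : tensor => G0 (vsval (t : tens_space))).
  by move=> a u v; rewrite vsval_lin G0l.
exists (llinfun Fl); split=> [m x|F' F'p].
  rewrite llinfunE -(G0p m x); apply/eqP; rewrite -subr_eq0 -(lin_B G0l).
  by rewrite G0r // -quot_proj_eq0 linearB /= quot_projK subrr.
apply/lfunP=> t; have [x ->] := tensor_gen t.
rewrite !linear_sum; apply: eq_bigr => i _ /=.
rewrite F'p llinfunE -(G0p _ (x i)); apply/eqP.
rewrite -subr_eq0 -(lin_B G0l).
by rewrite G0r // -quot_proj_eq0 linearB /= quot_projK subrr.
Qed.

End Tensor.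

Section SplitExtensions.
Variables (K : fieldType).

Definition right_ideal (R : falgType K) (I : {vspace R}) : Prop :=
  forall x y, x \in I -> x * y \in I.

Definition maximal_right_ideal (R : falgType K) (I : {vspace R}) : Prop :=
  [/\ right_ideal I, I <> fullv &
      forall J : {vspace R}, right_ideal J -> (I <= J)%VS ->
        J = I \/ J = fullv].

Definition in_jacobson_radical (R : falgType K) (x : R) : Prop :=
  forall I : {vspace R}, maximal_right_ideal I -> x \in I.

Record split_ext (R A : falgType K) := SplitExt {
  se_map :> {lrmorphism R -> A};
  se_sec : {lrmorphism A -> R};
  se_secK : cancel se_sec se_map;
  se_rad : forall x, se_map x = 0 -> in_jacobson_radical x }.

Variables (A R : falgType K) (xi : split_ext R A).
Local Notation sec := (se_sec xi).

Definition ext_lmod : lmod A.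
Proof.
apply: (@LMod K A R (fun a r => sec a * r)).
- by move=> m c a b; rewrite linearP mulrDl scalerAl.
- by move=> b c u v; rewrite mulrDr scalerAr.
- by move=> m; rewrite rmorph1 mul1r.
- by move=> a b m; rewrite rmorphM mulrA.
Defined.

Definition ext_bimod : bimod A R.
Proof.
apply: (@BiMod K A R ext_lmod (fun r s => r * s)).
- by move=> b c u v; rewrite mulrDl scalerAl.
- by move=> m c u v; rewrite mulrDr scalerAr.
- by move=> m; rewrite mulr1.
- by move=> m a b; rewrite mulrA.
- by move=> a m b; rewrite /= mulrA.
Defined.

Definition ext_ker : {vspace R} := lker (linfun xi).

Fact mem_ext_ker x : (x \in ext_ker) = (xi x == 0).
Proof. by rewrite memv_ker lfunE. Qed.

Definition ker_lact (a : A) (q : subvs_of ext_ker) : subvs_of ext_ker :=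
  vsproj ext_ker (sec a * vsval q).
Definition ker_ract (q : subvs_of ext_ker) (b : A) : subvs_of ext_ker :=
  vsproj ext_ker (vsval q * sec b).

Fact xi_vsval (q : subvs_of ext_ker) : xi (vsval q) = 0.
Proof. by apply/eqP; rewrite -mem_ext_ker subvsP. Qed.
Fact vsval_ker_lact a q : vsval (ker_lact a q) = sec a * vsval q.
Proof. by rewrite vsprojK // mem_ext_ker rmorphM [X in _ * X]xi_vsval mulr0. Qed.
Fact vsval_ker_ract q b : vsval (ker_ract q b) = vsval q * sec b.
Proof. by rewrite vsprojK // mem_ext_ker rmorphM [X in X * _]xi_vsval mul0r. Qed.

Definition ker_lmod : lmod A.
Proof.
apply: (@LMod K A (subvs_of ext_ker) ker_lact).
- move=> m c a b; apply: vsval_inj.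
  by rewrite [RHS]vsval_lin !vsval_ker_lact linearP mulrDl scalerAl.
- move=> b c u v; apply: vsval_inj.
  by rewrite [RHS]vsval_lin !vsval_ker_lact vsval_lin mulrDr scalerAr.
- by move=> m; apply: vsval_inj; rewrite vsval_ker_lact rmorph1 mul1r.
- by move=> a b m; apply: vsval_inj; rewrite !vsval_ker_lact rmorphM mulrA.
Defined.

Definition ker_bimod : bimod A A.
Proof.
apply: (@BiMod K A A ker_lmod ker_ract).
- move=> b c u v; apply: vsval_inj.
  by rewrite [RHS]vsval_lin !vsval_ker_ract vsval_lin mulrDl scalerAl.
- move=> m c a b; apply: vsval_inj.
  by rewrite [RHS]vsval_lin !vsval_ker_ract linearP mulrDr scalerAr.
- by move=> m; apply: vsval_inj; rewrite vsval_ker_ract rmorph1 mulr1.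
- by move=> m a b; apply: vsval_inj; rewrite !vsval_ker_ract rmorphM mulrA.
- move=> a m b; apply: vsval_inj.
  by rewrite /= vsval_ker_ract !vsval_ker_lact vsval_ker_ract mulrA.
Defined.

Definition projective_ext : Prop := lprojective ext_lmod.

End SplitExtensions.

(* Main.v *)
From HB Require Import structures.
Require Import Defs.
From mathcomp Require Import all_boot all_order all_algebra.
From mathcomp Require Import falgebra ring_quotient boolp freeg.

Set Implicit Arguments.
Unset Strict Implicit.
Unset Printing Implicit Defensive.

Import GRing.Theory.
Local Open Scope ring_scope.
Local Open Scope quotient_scope.

(** Write E for the (A, R)-bimodule R, Q for the kernel of xi, and N|A for the
    restriction of an R-module N along the section A -> R of xi.

    The homological part rests on the adjunction
      Hom_R(M (x) E, N) = Hom_A(M, N|A)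
    ([unit_map], [hom_extend]) and on the decomposition of A-modules
      (M (x) E)|A = M + M (x) Q
    ([tensor_split]), which comes from r = sec (xi r) + (r - sec (xi r)).
    Together they give
      Hom_R(M (x) E, N (x) E) = Hom_A(M, N) + Hom_A(M, N (x) Q).
    The same holds for Ext: as E is projective on the left, - (x) E is exact
    ([tens_map_exact]), and by the adjunction it preserves projectives
    ([tensor_projective]), so that it turns a projective resolution of M into
    one of M (x) E ([tensor_res]).  Ext is defined on one particular
    resolution, and the vanishing of its groups is shown not to depend on that
    choice ([ext_of_eq0_indep]).  Under the hypotheses the Q-summands vanish:
    Hom and Ext between the M_j (x) E vanish wherever those between the M_j do,
    and every endomorphism of M_k (x) E is a scalar.  A nonzero module with
    only scalar endomorphisms is indecomposable, because the projections
    attached to a decomposition are endomorphisms.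

    Completeness is a statement about the ranks of K0(A) and K0(R), and these
    groups are isomorphic: restriction along xi and along the section are exact
    and induce maps between them, one of whose composites comes from
    xi \o sec = id.  The other composite replaces an R-module X by its twist,
    on which b acts as sec (xi b).  Since Q lies in the radical, Q maps X into
    each of its maximal submodules Y ([radical_act_maximal]); hence the twist
    does not change X / Y, and X and its twist have the same class by induction
    on the dimension ([twist_rel]). *)

(** * Homomorphisms, submodules and quotients *)

Section ModuleHoms.
Variables (K : fieldType) (B : falgType K).
Implicit Types (L M N X Y P : rmod B).

Lemma limg_exP (U V : vectType K) (f : 'Hom(U, V)) v :
  v \in limg f <-> exists u, v = f u.
Proof.
split=> [/memv_imgP[u _ ->]|[u ->]]; first by exists u.
exact: memv_img (memvf u).
Qed.

Lemma surj_exP (U V : vectType K) (f : 'Hom(U, V)) :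
  limg f = fullv <-> forall v, exists u, v = f u.
Proof.
split=> [fS v|fS]; first by apply/limg_exP; rewrite fS memvf.
by apply/vspaceP=> v; rewrite memvf; apply/limg_exP.
Qed.

Lemma is_hom_comp L M N (g : 'Hom(M, N)) (f : 'Hom(L, M)) :
  is_hom g -> is_hom f -> is_hom (g \o f)%VF.
Proof. by move=> gH fH m b; rewrite !comp_lfunE fH gH. Qed.

Lemma is_hom_id M : is_hom (\1%VF : 'Hom(M, M)).
Proof. by move=> m b; rewrite !id_lfunE. Qed.

Lemma is_homD M N (f g : 'Hom(M, N)) : is_hom f -> is_hom g -> is_hom (f + g).
Proof. by move=> /mem_homB fH /mem_homB gH; apply/mem_homB; apply: memvD. Qed.

Lemma is_homB M N (f g : 'Hom(M, N)) : is_hom f -> is_hom g -> is_hom (f - g).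
Proof. by move=> /mem_homB fH /mem_homB gH; apply/mem_homB; apply: memvB. Qed.

Lemma is_homZ M N a (f : 'Hom(M, N)) : is_hom f -> is_hom (a *: f).
Proof. by move=> /mem_homB fH; apply/mem_homB; apply: memvZ. Qed.

Lemma homB_eq0 M N :
  homB M N = 0%VS <-> forall f : 'Hom(M, N), is_hom f -> f = 0.
Proof.
split=> [h0 f /mem_homB|h0]; first by rewrite h0 memv0 => /eqP.
apply/eqP; rewrite -subv0; apply/subvP=> f /mem_homB/h0 ->.
exact: mem0v.
Qed.

Lemma stable_limg M N (f : 'Hom(M, N)) : is_hom f -> stable (limg f).
Proof. by move=> fH _ b /limg_exP[u ->]; apply/limg_exP; exists (ract u b). Qed.

Section SubQuotient.
Variables (M : rmod B) (U : {vspace M}) (sU : stable U).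

Definition sub_act (u : subvs_of U) (b : B) : subvs_of U :=
  vsproj U (ract (vsval u) b).

Fact vsval_sub_act u b : vsval (sub_act u b) = ract (vsval u) b.
Proof. by rewrite vsprojK // sU // subvsP. Qed.
Fact sub_act_linl b : linear (sub_act^~ b).
Proof.
move=> a u v; apply: vsval_inj.
by rewrite [RHS]vsval_lin !vsval_sub_act vsval_lin ract_linl.
Qed.
Fact sub_act_linr u : linear (sub_act u).
Proof.
move=> a b c; apply: vsval_inj.
by rewrite [RHS]vsval_lin !vsval_sub_act ract_linr.
Qed.
Fact sub_act1 u : sub_act u 1 = u.
Proof. by apply: vsval_inj; rewrite vsval_sub_act ract1. Qed.
Fact sub_actM u a b : sub_act u (a * b) = sub_act (sub_act u a) b.
Proof. by apply: vsval_inj; rewrite !vsval_sub_act ractM. Qed.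

Definition sub_rmod : rmod B :=
  RMod sub_act_linl sub_act_linr sub_act1 sub_actM.
Definition sub_incl : 'Hom(sub_rmod, M) := linfun vsval.

Lemma sub_inclE u : sub_incl u = vsval u. Proof. exact: lfunE. Qed.

Lemma sub_incl_hom : is_hom sub_incl.
Proof. by move=> u b; rewrite !sub_inclE vsval_sub_act. Qed.

Definition quot_act (u : quotv U) (b : B) : quotv U :=
  quot_proj U (ract (vsval u) b).

Fact quot_act_proj m b : quot_act (quot_proj U m) b = quot_proj U (ract m b).
Proof.
apply/eqP; rewrite /quot_act -subr_eq0 -linearB quot_proj_eq0.
rewrite -(lin_B (ract_linl b)) sU //.
by rewrite -quot_proj_eq0 linearB /= quot_projK subrr.
Qed.
Fact quot_act_linl b : linear (quot_act^~ b).
Proof. by move=> a u v; rewrite /quot_act vsval_lin ract_linl linearP. Qed.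
Fact quot_act_linr u : linear (quot_act u).
Proof. by move=> a b c; rewrite /quot_act ract_linr linearP. Qed.
Fact quot_act1 u : quot_act u 1 = u.
Proof. by rewrite -[u]quot_projK quot_act_proj ract1. Qed.
Fact quot_actM u a b : quot_act u (a * b) = quot_act (quot_act u a) b.
Proof. by rewrite -[u]quot_projK !quot_act_proj ractM. Qed.

Definition quot_rmod : rmod B :=
  RMod quot_act_linl quot_act_linr quot_act1 quot_actM.
Definition quot_map : 'Hom(M, quot_rmod) := quot_proj U.

Lemma quot_map_hom : is_hom quot_map.
Proof. by move=> m b; rewrite /= quot_act_proj. Qed.

Lemma sub_quot_ses : ses sub_rmod M quot_rmod.
Proof.
exists sub_incl, quot_map; split.
- exact: sub_incl_hom.
- exact: quot_map_hom.
- by apply/eqP/lker0P=> u v; rewrite !sub_inclE => /vsval_inj.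
- apply/vspaceP=> m; rewrite memv_ker quot_proj_eq0.
  apply/idP/idP=> [/limg_exP[u ->]|Um]; first by rewrite sub_inclE subvsP.
  by apply/limg_exP; exists (vsproj U m); rewrite sub_inclE vsprojK.
- by apply/surj_exP=> u; exists (vsval u); rewrite /quot_map quot_projK.
Qed.

End SubQuotient.

(** Projectivity is a lifting property against surjections; it applies here to
    the corestriction of g to its image.  In this form it produces all the chain
    maps and homotopies below. *)
Lemma projective_lift P X Y (g : 'Hom(X, Y)) (f : 'Hom(P, Y)) :
  projective P -> is_hom g -> is_hom f -> (forall p, f p \in limg g) ->
  exists h : 'Hom(P, X), is_hom h /\ forall p, g (h p) = f p.
Proof.
move=> pP gH fH fg; pose I := limg g; have sI := stable_limg gH.
have gI x : g x \in I by apply/limg_exP; exists x.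
pose g' : 'Hom(X, sub_rmod sI) := (linfun (vsproj I) \o g)%VF.
pose f' : 'Hom(P, sub_rmod sI) := (linfun (vsproj I) \o f)%VF.
have g'E x : vsval (g' x) = g x by rewrite comp_lfunE lfunE /= vsprojK.
have f'E p : vsval (f' p) = f p by rewrite comp_lfunE lfunE /= vsprojK ?fg.
have g'H : is_hom g'.
  by move=> x b; apply: vsval_inj; rewrite vsval_sub_act // !g'E gH.
have f'H : is_hom f'.
  by move=> x b; apply: vsval_inj; rewrite vsval_sub_act // !f'E fH.
have [|h [hH gh]] := pP _ _ g' f' g'H _ f'H.
  apply/surj_exP=> u; have /limg_exP[x ux] := subvsP u.
  by exists x; apply: vsval_inj; rewrite g'E.
exists h; split=> // p.
by rewrite -g'E -f'E -gh comp_lfunE.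
Qed.

End ModuleHoms.

Arguments pr_proj {K B M} p n X Y g f.
Arguments pr_d_hom {K B M} p n m b.
Arguments pr_aug_hom {K B M} p m b.
Arguments is_hom_id {K B} M m b.

(** * Comparison of projective resolutions *)

Section Comparison.
Variables (K : fieldType) (B : falgType K).
Implicit Types M N : rmod B.

(** Chain maps and homotopies are sequences whose n-th term lives in a type
    depending on n and whose next term exists only if the current one satisfies
    an invariant, namely P. *)
Lemma dependent_choice_seq (T : nat -> Type) (P : forall n, T n -> Prop)
    (S : forall n, T n -> T n.+1 -> Prop) :
  (exists x, P 0%N x) ->
  (forall n x, P n x -> exists y, P n.+1 y /\ S n x y) ->
  exists f : forall n, T n, P 0%N (f 0%N) /\ forall n, S n (f n) (f n.+1).
Proof.
move=> /cid[x0 Px0] step.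
pose next n (s : {x | P n x}) :=
  let: exist y p := cid (step n _ (svalP s)) in exist (P n.+1) y p.1.
pose F := fix F n : {x | P n x} :=
  if n is m.+1 then next m (F m) else exist _ x0 Px0.
have nextS n s : S n (sval s) (sval (next n s)).
  by rewrite /next; case: (cid _) => y [].
by exists (fun n => sval (F n)); split=> [//|n]; apply: nextS.
Qed.

Lemma pr_dd M (P : projres M) n x : pr_d P n (pr_d P n.+1 x) = 0.
Proof.
by apply/eqP; rewrite -memv_ker pr_exactS; apply/limg_exP; exists x.
Qed.

Lemma pr_aug_d M (P : projres M) x : pr_aug P (pr_d P 0%N x) = 0.
Proof.
by apply/eqP; rewrite -memv_ker pr_exact0; apply/limg_exP; exists x.
Qed.

(** Ext is realised on a complement of the coboundaries, so it vanishes exactly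
    when every cocycle is a coboundary. *)
Lemma ext_of_eq0 M N (P : projres M) n :
  ext_of N P n.+1 = 0%VS <->
  forall f : 'Hom(P n.+1, N), is_hom f ->
    (forall x, f (pr_d P n.+1 x) = 0) ->
    exists g : 'Hom(P n, N), is_hom g /\ forall x, f x = g (pr_d P n x).
Proof.
have cocP (f : 'Hom(P n.+1, N)) : f \in cocycles N P n.+1 <->
    is_hom f /\ forall x, f (pr_d P n.+1 x) = 0.
  rewrite memv_cap memv_ker precompE; split.
    case/andP=> /mem_homB fH /eqP fd; split=> // x.
    by rewrite -comp_lfunE fd lfunE.
  case=> /mem_homB -> fd; apply/eqP/lfunP=> x.
  by rewrite comp_lfunE fd lfunE.
have cobP (f : 'Hom(P n.+1, N)) : f \in coboundaries N P n.+1 <->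
    exists g : 'Hom(P n, N), is_hom g /\ forall x, f x = g (pr_d P n x).
  split=> [/memv_imgP[g /mem_homB gH ->]|[g [/mem_homB gH fg]]].
    by exists g; split=> // x; rewrite precompE comp_lfunE.
  apply/memv_imgP; exists g => //; rewrite precompE.
  by apply/lfunP=> x; rewrite comp_lfunE.
rewrite (rwP eqP) diffv_eq0; split=> [/subvP sub f fH fd|sub].
  by apply/cobP/sub/cocP.
by apply/subvP=> f /cocP[fH fd]; apply/cobP/sub.
Qed.

(** The invariant that keeps the recursion going is that a_n maps boundaries to
    boundaries; it follows from the commutation with the previous differential
    by exactness of the target. *)
Lemma chain_lift M (P Q : projres M) :
  exists a : forall n, 'Hom(P n, Q n),
    [/\ forall n, is_hom (a n),
        forall x, pr_aug Q (a 0%N x) = pr_aug P x &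
        forall n x, pr_d Q n (a n.+1 x) = a n (pr_d P n x)].
Proof.
have [|a0 [a0H a0E]] := projective_lift (pr_proj P 0%N) (pr_aug_hom Q)
                            (pr_aug_hom P).
  by move=> p; rewrite pr_aug_surj memvf.
have [||a [[aH0 aug _] aS]] := @dependent_choice_seq
  (fun n => 'Hom(P n, Q n))
  (fun n a => [/\ is_hom a,
     (if n is 0 then fun a : 'Hom(P 0%N, Q 0%N) =>
        forall x, pr_aug Q (a x) = pr_aug P x else fun=> True) a &
     forall x, a (pr_d P n x) \in limg (pr_d Q n)])
  (fun n a a' => is_hom a' /\ forall x, pr_d Q n (a' x) = a (pr_d P n x)).
- exists a0; split=> // x.
  by rewrite -pr_exact0 memv_ker a0E pr_aug_d.
- move=> n a [aH _ ad].
  have [||a' [a'H a'E]] := projective_lift (g := pr_d Q n)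
      (f := (a \o pr_d P n)%VF) (pr_proj P n.+1) (pr_d_hom Q n).
  + exact: is_hom_comp (pr_d_hom P n).
  + by move=> p; rewrite comp_lfunE.
  exists a'; split; [split=> // x|split=> // x]; last by rewrite a'E comp_lfunE.
  by rewrite -pr_exactS memv_ker a'E comp_lfunE pr_dd linear0.
exists a; split=> // [[|n]|n x] //; by have [] := aS n.
Qed.

(** The invariant d s_n d = u_n d says that u_{n+1} - s_n d takes its values in
    the cycles, so that it lifts along d; it has the same form in degree 0. *)
Lemma null_homotopy M (P : projres M) (u : forall n, 'Hom(P n, P n)) :
  (forall n, is_hom (u n)) -> (forall x, pr_aug P (u 0%N x) = 0) ->
  (forall n x, pr_d P n (u n.+1 x) = u n (pr_d P n x)) ->
  exists s : forall n, 'Hom(P n, P n.+1), (forall n, is_hom (s n)) /\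
    forall n x, u n.+1 x = pr_d P n.+1 (s n.+1 x) + s n (pr_d P n x).
Proof.
move=> uH u0 ud.
have [||s [[s0H _] sS]] := @dependent_choice_seq
  (fun n => 'Hom(P n, P n.+1))
  (fun n s => is_hom s /\
     forall x, pr_d P n (s (pr_d P n x)) = u n (pr_d P n x))
  (fun n s s' => is_hom s' /\
     forall x, u n.+1 x = pr_d P n.+1 (s' x) + s (pr_d P n x)).
- have [|s [sH sE]] :=
    projective_lift (pr_proj P 0%N) (pr_d_hom P 0%N) (uH 0%N).
    by move=> p; rewrite -pr_exact0 memv_ker u0.
  by exists s.
- move=> n s [sH sE].
  have [||s' [s'H s'E]] := projective_lift (g := pr_d P n.+1)
      (f := u n.+1 - (s \o pr_d P n)%VF) (pr_proj P n.+1) (pr_d_hom P n.+1).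
  + by apply: is_homB => //; apply: is_hom_comp (pr_d_hom P n).
  + move=> p; rewrite -pr_exactS memv_ker add_lfunE opp_lfunE comp_lfunE.
    by rewrite linearB /= ud sE subrr.
  have E x : pr_d P n.+1 (s' x) = u n.+1 x - s (pr_d P n x).
    by rewrite s'E add_lfunE opp_lfunE comp_lfunE.
  exists s'; split; split=> // x; last by rewrite E subrK.
  by rewrite E pr_dd linear0 subr0.
by exists s; split=> [[|n]|n x] //; have [] := sS n.
Qed.

(** For chain maps a : Q -> P and b : P -> Q over the identity and a homotopy s
    from b a to the identity, a cocycle f on Q pulls back to the cocycle f b on
    P, say f b = g d; then f = f b a - f (d s + s d) = (g a - f s) d. *)
Lemma ext_of_eq0_indep M N (P Q : projres M) n :
  ext_of N P n.+1 = 0%VS -> ext_of N Q n.+1 = 0%VS.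
Proof.
move=> /ext_of_eq0 exP; apply/ext_of_eq0 => f fH fd.
have [a [aH aug_a ad]] := chain_lift Q P.
have [b [bH aug_b bd]] := chain_lift P Q.
pose u k : 'Hom(Q k, Q k) := (b k \o a k)%VF - \1%VF.
have uE k x : u k x = b k (a k x) - x.
  by rewrite add_lfunE opp_lfunE comp_lfunE id_lfunE.
have [|||s [sH sE]] := @null_homotopy M Q u.
- by move=> k; apply: is_homB (is_hom_id _); apply: is_hom_comp.
- by move=> x; rewrite uE linearB /= aug_b aug_a subrr.
- by move=> k x; rewrite !uE linearB /= bd ad.
have [||g [gH gE]] := exP (f \o b n.+1)%VF.
- exact: is_hom_comp.
- by move=> x; rewrite comp_lfunE -bd fd.
exists ((g \o a n) - (f \o s n))%VF; split.
  by apply: is_homB; apply: is_hom_comp.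
move=> x; rewrite add_lfunE opp_lfunE !comp_lfunE -ad -gE comp_lfunE.
have := uE n.+1 x; rewrite sE => /(congr1 f).
by rewrite linearD /= fd add0r linearB /= => ->; rewrite opprB addrC subrK.
Qed.

End Comparison.

(** * Exactness of the tensor product with a projective left module *)

Section DualBasis.
Variables (K : fieldType) (A : falgType K).

Definition lfree_act (n : nat) (a : A) (f : {ffun 'I_n -> A}) :
    {ffun 'I_n -> A} :=
  [ffun i => a * f i].

Definition lfree (n : nat) : lmod A.
Proof.
apply: (@LMod K A {ffun 'I_n -> A} (@lfree_act n)).
- by move=> f c a b; apply/ffunP=> i; rewrite !ffunE mulrDl scalerAl.
- by move=> a c f g; apply/ffunP=> i; rewrite !ffunE mulrDr scalerAr.
- by move=> f; apply/ffunP=> i; rewrite ffunE mul1r.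
- by move=> a b f; apply/ffunP=> i; rewrite !ffunE mulrA.
Defined.

(** A projective module splits off the free module on a generating family; the
    coordinates of the splitting are the functionals phi. *)
Lemma dual_basis (X : lmod A) : lprojective X ->
  exists n (e : 'I_n -> X) (phi : X -> 'I_n -> A),
    [/\ forall i, linear (phi^~ i),
        forall a x i, phi (lact a x) i = a * phi x i &
        forall x, x = \sum_i lact (phi x i) (e i)].
Proof.
move=> pX; pose n := \dim {:X}; pose e (i : 'I_n) : X := (vbasis {:X})`_i.
pose p (f : lfree n) : X := \sum_i lact (f i) (e i).
have p_lin : linear p.
  move=> a f g; rewrite scaler_sumr -big_split; apply: eq_bigr => i _ /=.
  by rewrite !ffunE lact_linl.
have pH : is_lhom (llinfun p_lin).
  move=> a f; rewrite !llinfunE /p (lin_sum (lact_linr a)).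
  by apply: eq_bigr => i _; rewrite ffunE lactM.
have pS : limg (llinfun p_lin) = fullv.
  apply/surj_exP => x.
  exists ([ffun i => coord (vbasis {:X}) i x *: 1] : {ffun 'I_n -> A}).
  rewrite llinfunE {1}(coord_vbasis (memvf x)); apply: eq_bigr => i _.
  by rewrite ffunE (lin_Z (lact_linl _)) lact1.
have [|h [hH ph]] := pX _ _ _ (\1%VF : 'Hom(X, X)) pH pS.
  by move=> a x; rewrite !id_lfunE.
exists n, e, (fun x i => h x i); split=> [i c x y|a x i|x].
- by rewrite linearP !ffunE.
- by rewrite hH ffunE.
- have := congr1 (fun f : 'End(X) => f x) ph.
  by rewrite comp_lfunE id_lfunE llinfunE.
Qed.

End DualBasis.

Section TensorMaps.
Variables (K : fieldType) (A B : falgType K) (X : bimod A B).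

Lemma tensor_lift (M : rmod A) (V : vectType K) (f : M -> X -> V) :
  (forall x, linear (f^~ x)) -> (forall m, linear (f m)) ->
  (forall m a x, f (ract m a) x = f m (lact a x)) ->
  {F : 'Hom(tensor M X, V) | forall m x, F (pure m x) = f m x}.
Proof.
move=> fl fr fb; apply: cid.
by have [F [FE _]] := tensor_univ fl fr fb; exists F.
Qed.

Lemma tensor_hom_eq (M : rmod A) (V : vectType K) (F G : 'Hom(tensor M X, V)) :
  (forall m x, F (pure m x) = G (pure m x)) -> F =1 G.
Proof.
move=> FG t; have [x ->] := tensor_gen t.
by rewrite !linear_sum; apply: eq_bigr => i _; apply: FG.
Qed.

Lemma tensor_is_hom (M : rmod A) (N : rmod B) (F : 'Hom(tensor M X, N)) :
  (forall m x b, F (pure m (bract x b)) = ract (F (pure m x)) b) -> is_hom F.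
Proof.
move=> FH t b; have [x ->] := tensor_gen t.
rewrite (lin_sum (ract_linl b)) !linear_sum (lin_sum (ract_linl b)).
by apply: eq_bigr => i _; rewrite pure_act; apply: FH.
Qed.

Section Functor.
Variables (M N : rmod A) (f : 'Hom(M, N)) (fH : is_hom f).

Fact tens_map_spec : {F : 'Hom(tensor M X, tensor N X) |
  forall m x, F (pure m x) = pure (f m) x}.
Proof.
apply: tensor_lift => [x a u v|m a u v|m a x].
- by rewrite linearP pure_linl.
- by rewrite pure_linr.
- by rewrite fH pure_balanced.
Qed.

Definition tens_map : 'Hom(tensor M X, tensor N X) := sval tens_map_spec.

Lemma tens_mapE m x : tens_map (pure m x) = pure (f m) x.
Proof. exact: (svalP tens_map_spec). Qed.

Lemma tens_map_hom : is_hom tens_map.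
Proof. by apply: tensor_is_hom => m x b; rewrite !tens_mapE pure_act. Qed.

Lemma tens_map_surj : limg f = fullv -> limg tens_map = fullv.
Proof.
move=> /surj_exP fS; apply/surj_exP => t; have [x ->] := tensor_gen t.
have /choice[g gE] := fS.
exists (\sum_(i < \dim {:N}) pure (g (vbasis {:N})`_i) (x i)).
by rewrite linear_sum; apply: eq_bigr => i _; rewrite /= tens_mapE -gE.
Qed.

End Functor.

(** With a dual basis (e_i, phi_i) of X, every t in P (x) X equals
    sum_i theta_i t (x) e_i, where theta_i : P (x) X -> P sends p (x) x to
    p phi_i(x).  As the theta_i are natural in P, elements of the kernel of
    g (x) X have coordinates in the kernel of g, that is, in the image of f. *)
Lemma tens_map_exact (L M N : rmod A) (f : 'Hom(L, M)) (g : 'Hom(M, N))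
    (fH : is_hom f) (gH : is_hom g) :
  lprojective X -> lker g = limg f ->
  lker (tens_map gH) = limg (tens_map fH).
Proof.
move=> /dual_basis[n [e [phi [phi_lin phiH phiE]]]] ex.
have theta (P : rmod A) i : {F : 'Hom(tensor P X, P) |
    forall m x, F (pure m x) = ract m (phi x i)}.
  apply: tensor_lift => [x|m a u v|m a x]; first exact: ract_linl.
  - by rewrite phi_lin ract_linr.
  - by rewrite phiH ractM.
have recon (P : rmod A) t : t = \sum_i pure (sval (theta P i) t) (e i).
  have lin : linear (fun t => \sum_i pure (sval (theta P i) t) (e i)).
    move=> c u v; rewrite scaler_sumr -big_split; apply: eq_bigr => i _ /=.
    by rewrite linearP pure_linl.
  have E : \1%VF =1 llinfun lin.
    apply: tensor_hom_eq => m z; rewrite id_lfunE llinfunE {1}(phiE z).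
    rewrite (lin_sum (pure_linr m)); apply: eq_bigr => i _.
    by rewrite -pure_balanced (svalP (theta P i)).
  by have := E t; rewrite id_lfunE llinfunE.
have nat i t : sval (theta N i) (tens_map gH t) = g (sval (theta M i) t).
  rewrite -!comp_lfunE; apply: tensor_hom_eq => m x.
  by rewrite !comp_lfunE tens_mapE !(svalP (theta _ i)) gH.
apply/vspaceP=> t; apply/idP/idP.
  rewrite memv_ker => /eqP gt0.
  have /choice[l lE] i : exists l, sval (theta M i) t = f l.
    by apply/limg_exP; rewrite -ex memv_ker -nat gt0 linear0.
  apply/limg_exP; exists (\sum_i pure (l i) (e i)).
  rewrite linear_sum {1}(recon _ t); apply: eq_bigr => i _.
  by rewrite /= tens_mapE lE.
case/limg_exP=> s ->; rewrite memv_ker -comp_lfunE; apply/eqP.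
have -> : 0 = (0 : 'Hom(tensor L X, tensor N X)) s by rewrite lfunE.
apply: tensor_hom_eq => m x; rewrite comp_lfunE !tens_mapE lfunE.
have /eqP-> : g (f m) == 0 by rewrite -memv_ker ex; apply/limg_exP; exists m.
by rewrite (lin_0 (pure_linl x)).
Qed.

End TensorMaps.

(** * Base change along a split extension *)

Section Pullback.
Variables (K : fieldType) (A B : falgType K) (phi : {lrmorphism B -> A}).

Definition pull_rmod (M : rmod A) : rmod B.
Proof.
apply: (@RMod K B M (fun m b => ract m (phi b))).
- by move=> b c u v; rewrite ract_linl.
- by move=> m c a b; rewrite linearP ract_linr.
- by move=> m; rewrite rmorph1 ract1.
- by move=> m a b; rewrite rmorphM ractM.
Defined.

End Pullback.

Section BaseChange.
Variables (K : fieldType) (A R : falgType K) (xi : split_ext R A).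
Local Notation sec := (se_sec xi).
Local Notation E := (ext_bimod xi).
Local Notation Q := (ker_bimod xi).
Local Notation restr := (pull_rmod sec).
Local Notation pureR := (@pure _ _ _ _ E).
Implicit Types M N : rmod A.

Fact unit_linear M : linear (fun m : M => pureR m 1).
Proof. by move=> c u v; apply: (pure_linl (X := E)). Qed.

Definition unit_map M : 'Hom(M, restr (tensor M E)) := llinfun (@unit_linear M).

Lemma unit_mapE M m : unit_map M m = pureR m 1 :> tensor M E.
Proof. exact: llinfunE. Qed.

Lemma pure_unit M (m : M) (r : R) :
  pureR m r = ract (pureR m 1) r.
Proof. by rewrite pure_act /= mul1r. Qed.

Lemma unit_map_hom M : is_hom (unit_map M).
Proof.
move=> m a.
change (unit_map M (ract m a) = @ract _ _ (tensor M E) (unit_map M m) (sec a)).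
by rewrite !unit_mapE pure_balanced -pure_unit /= mulr1.
Qed.

(** With [unit_map], this is the adjunction between - (x) E and restriction
    along the section. *)
Lemma hom_extend M (X : rmod R) (g : 'Hom(M, restr X)) : is_hom g ->
  {G : 'Hom(tensor M E, X) | is_hom G /\
     forall m (r : R), G (pureR m r) = ract (g m : X) r}.
Proof.
move=> gH.
have [|||G GE] := @tensor_lift K A R E M X (fun m (r : R) => ract (g m : X) r).
- by move=> r a u v; rewrite linearP; apply: (@ract_linl _ _ X).
- by move=> m; apply: ract_linr.
- by move=> m a x; rewrite gH /= ractM.
exists G; split=> //; apply: tensor_is_hom => m x b.
by rewrite !GE /= ractM.
Qed.

(** A left adjoint of an exact functor preserves projectives. *)
Lemma tensor_projective M : projective M -> projective (tensor M E).
Proof.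
move=> pM X Y g f gH gS fH.
have [||||h [hH gh]] := @projective_lift K A M (restr X) (restr Y) g
                          (f \o unit_map M)%VF.
- exact: pM.
- by move=> m a; apply: gH.
- by move=> m a; rewrite !comp_lfunE unit_map_hom; apply: fH.
- by move=> p; rewrite gS memvf.
have [G [GH GE]] := hom_extend hH.
exists G; split=> //; apply/lfunP; apply: tensor_hom_eq => m r.
rewrite comp_lfunE GE gH; have -> : g (h m) = f (pureR m 1).
  by rewrite [LHS]gh comp_lfunE unit_mapE.
by rewrite -fH -pure_unit.
Qed.

Definition tensor_res (h : projective_ext xi) M (P : projres M) :
  projres (tensor M E) :=
  @ProjRes K R (tensor M E) (fun n => tensor (P n) E)
    (fun n => tens_map E (pr_d_hom P n)) (tens_map E (pr_aug_hom P))
    (fun n => tensor_projective (pr_proj P n))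
    (fun n => tens_map_hom (pr_d_hom P n)) (tens_map_hom (pr_aug_hom P))
    (tens_map_surj E (pr_aug_hom P) (pr_aug_surj P))
    (tens_map_exact (X := E) (pr_d_hom P 0%N) (pr_aug_hom P) h (pr_exact0 P))
    (fun n => tens_map_exact (X := E)
       (pr_d_hom P n.+1) (pr_d_hom P n) h (pr_exactS P n)).

Lemma xi_secl a (r : R) : xi (sec a * r) = a * xi r.
Proof. by rewrite rmorphM [X in X * _]se_secK. Qed.

Lemma xi_secr (r : R) a : xi (r * sec a) = xi r * a.
Proof. by rewrite rmorphM [X in _ * X]se_secK. Qed.

Section Splitting.
Variable N : rmod A.

Fact head_map_spec : {p : 'Hom(restr (tensor N E), N) |
  is_hom p /\ forall n (r : R), p (pureR n r) = ract n (xi r)}.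
Proof.
have [|||p pE] := @tensor_lift K A R E N N (fun n (r : R) => ract n (xi r)).
- by move=> r; apply: ract_linl.
- by move=> n c a b; rewrite linearP ract_linr.
- by move=> n a r; rewrite /= xi_secl ractM.
exists p; split=> // t a; have [x ->] := tensor_gen t.
rewrite (lin_sum (@ract_linl _ _ (restr _) a)) !linear_sum.
rewrite (lin_sum (ract_linl a)).
apply: eq_bigr => i _.
have -> : ract (pureR (vbasis {:N})`_i (x i) : restr (tensor N E)) a =
  pureR (vbasis {:N})`_i ((x i : R) * sec a) by exact: (pure_act (X := E)).
by rewrite /= !pE xi_secr ractM.
Qed.

Lemma mem_ker_part (r : R) : r - sec (xi r) \in ext_ker xi.
Proof. by rewrite mem_ext_ker linearB /= se_secK subrr. Qed.

Definition ker_part (r : R) : Q := vsproj (ext_ker xi) (r - sec (xi r)).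

Lemma vsval_ker_part r : vsval (ker_part r) = r - sec (xi r).
Proof. by rewrite vsprojK ?mem_ker_part. Qed.

Fact tail_map_spec : {p : 'Hom(restr (tensor N E), tensor N Q) |
  is_hom p /\ forall n (r : R), p (pureR n r) = pure n (ker_part r)}.
Proof.
have [|||p pE] := @tensor_lift K A R E N (tensor N Q)
                    (fun n (r : R) => pure n (ker_part r)).
- by move=> r; apply: pure_linl.
- move=> n c a b; rewrite -pure_linr; congr (pure n _); apply: vsval_inj.
  rewrite [RHS]vsval_lin !vsval_ker_part !linearP /=.
  by rewrite scalerBr addrACA scalerN.
- move=> n a r; rewrite pure_balanced; congr (pure n _); apply: vsval_inj.
  by rewrite vsval_ker_lact !vsval_ker_part /= xi_secl rmorphM mulrBr.
exists p; split=> // t a; have [x ->] := tensor_gen t.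
rewrite (lin_sum (@ract_linl _ _ (restr _) a)) !linear_sum.
rewrite (lin_sum (ract_linl a)).
apply: eq_bigr => i _.
have -> : ract (pureR (vbasis {:N})`_i (x i) : restr (tensor N E)) a =
  pureR (vbasis {:N})`_i ((x i : R) * sec a) by exact: (pure_act (X := E)).
rewrite [LHS]pE [X in ract X]pE pure_act; congr (pure _ _); apply: vsval_inj.
by rewrite vsval_ker_ract !vsval_ker_part xi_secr rmorphM mulrBl.
Qed.

Fact tail_incl_spec : {j : 'Hom(tensor N Q, restr (tensor N E)) |
  is_hom j /\ forall n q, j (pure n q) = pureR n (vsval q)}.
Proof.
have [|||j jE] := @tensor_lift K A A Q N (restr (tensor N E))
    (fun n q => pureR n (vsval q)).
- by move=> q c u v; apply: (pure_linl (X := E)).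
- by move=> n c u v; rewrite vsval_lin; apply: (pure_linr (X := E)).
- move=> n a q; rewrite (pure_balanced (X := E)); congr (pure n _).
  by rewrite vsval_ker_lact.
exists j; split=> //; apply: tensor_is_hom => n q b.
rewrite !jE; rewrite /= vsval_ker_ract.
exact: esym (pure_act (X := E) _ _ _).
Qed.

Definition head_map := sval head_map_spec.
Definition tail_map := sval tail_map_spec.
Definition tail_incl := sval tail_incl_spec.

Lemma head_map_hom : is_hom head_map.
Proof. by case: (svalP head_map_spec). Qed.
Lemma tail_map_hom : is_hom tail_map.
Proof. by case: (svalP tail_map_spec). Qed.
Lemma tail_incl_hom : is_hom tail_incl.
Proof. by case: (svalP tail_incl_spec). Qed.

Lemma head_mapE n (r : R) : head_map (pureR n r) = ract n (xi r).
Proof. by case: (svalP head_map_spec) => _; apply. Qed.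
Lemma tail_mapE n (r : R) : tail_map (pureR n r) = pure n (ker_part r).
Proof. by case: (svalP tail_map_spec) => _; apply. Qed.
Lemma tail_inclE n (q : Q) : tail_incl (pure n q) = pureR n (vsval q).
Proof. by case: (svalP tail_incl_spec) => _; apply. Qed.

(** In r = sec (xi r) + (r - sec (xi r)) the second term lies in Q, and
    n (x) sec (xi r) = n xi(r) (x) 1 lies in the image of the unit. *)
Lemma tensor_split (t : restr (tensor N E)) :
  t = unit_map N (head_map t) + tail_incl (tail_map t).
Proof.
have H : (\1%VF : 'End(restr (tensor N E))) =1
    ((unit_map N \o head_map) + (tail_incl \o tail_map))%VF.
  apply: (tensor_hom_eq (X := E)) => n r.
  rewrite id_lfunE add_lfunE !comp_lfunE [head_map _]head_mapE.
  rewrite [tail_map _]tail_mapE [tail_incl _]tail_inclE unit_mapE.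
  rewrite vsval_ker_part (pure_balanced (X := E)) -[X in X + _]scale1r.
  rewrite -(pure_linr (X := E)).
  by rewrite scale1r /= mulr1 addrC subrK.
by have := H t; rewrite id_lfunE add_lfunE !comp_lfunE.
Qed.

Lemma head_map_unit n : head_map (unit_map N n) = n.
Proof. by rewrite unit_mapE [LHS]head_mapE rmorph1 ract1. Qed.

End Splitting.

End BaseChange.

(** * Modules with scalar endomorphisms *)

Section ScalarEndomorphisms.
Variables (K : fieldType) (B : falgType K).
Implicit Types M : rmod B.

(** The projection onto U along V is an endomorphism, hence a scalar a.
    If a = 0, then U is zero; otherwise V is, since a v lies in U and in V for
    every v in V. *)
Lemma indecomposable_of_scalar_end M :
  ({:M} != 0)%VS ->
  (forall f : 'End(M), is_hom f -> exists a : K, f = a *: \1%VF) ->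
  indecomposable M.
Proof.
move=> M0 scal; split=> // U V sU sV UV UV0.
have pU m : daddv_pi U V m \in U by exact: memv_pi.
have pV m : daddv_pi V U m \in V by exact: memv_pi.
have pUV m : daddv_pi U V m + daddv_pi V U m = m.
  by apply: daddv_pi_add; rewrite ?UV ?memvf.
have [a aE] : exists a : K, daddv_pi U V = a *: \1%VF.
  apply: scal => m b.
  (* The difference lies in U by stability of U, and in V because it is the
     opposite of the same difference for the projection onto V. *)
  have: daddv_pi U V (ract m b) - ract (daddv_pi U V m) b \in (U :&: V)%VS.
    rewrite memv_cap memvB ?sU //=.
    have -> : daddv_pi U V (ract m b) - ract (daddv_pi U V m) b =
        ract (daddv_pi V U m) b - daddv_pi V U (ract m b).
      have split_b : ract (daddv_pi U V m) b + ract (daddv_pi V U m) b =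
          daddv_pi U V (ract m b) + daddv_pi V U (ract m b).
        by rewrite pUV -[X in X + _]scale1r -ract_linl scale1r pUV.
      rewrite -[X in X - _](addrK (daddv_pi V U (ract m b))) -split_b.
      by rewrite addrAC [X in X - _]addrC addKr.
    by rewrite memvB ?sV.
  by rewrite UV0 memv0 subr_eq0 => /eqP.
have [a0|a0] := eqVneq a 0; [left|right].
  apply/eqP; rewrite -subv0; apply/subvP=> u Uu.
  rewrite -(daddv_pi_id UV0 Uu) aE a0 scale0r lfunE /=; exact: mem0v.
apply/eqP; rewrite -subv0; apply/subvP=> v Vv.
have : daddv_pi U V v \in (U :&: V)%VS.
  by rewrite memv_cap memv_pi aE scale_lfunE id_lfunE memvZ.
by rewrite UV0 !memv0 aE scale_lfunE id_lfunE scaler_eq0 (negPf a0).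
Qed.

(** An isomorphism from K to the endomorphism algebra is determined by its value
    at 1, so it must be the map onto the scalars. *)
Lemma end_iso_KP M :
  end_iso_K M <-> ({:M} != 0)%VS /\
    forall f : 'End(M), is_hom f -> exists a : K, f = a *: \1%VF.
Proof.
split=> [[phi [phi1 _ phiI phiP]]|[M0 scal]].
  split.
    apply/eqP=> M0; have /phiI/eqP : phi 1 = phi 0; last by rewrite oner_eq0.
    rewrite phi1 linear0; apply/lfunP=> m; apply/eqP.
    by rewrite -subr_eq0 -memv0 -M0 memvf.
  move=> f /mem_homB/phiP[a ->]; exists a; rewrite -phi1 -linearZ.
  by congr (phi _); rewrite /GRing.scale /= mulr1.
pose phi0 (a : K^o) : 'End(M) := a *: \1%VF.
have phil : linear phi0.
  by move=> c a b; rewrite /phi0 scalerDl scalerA.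
pose phi : {linear K^o -> 'End(M)} :=
  HB.pack phi0 (GRing.isSemilinear.Build K _ _ *:%R phi0
                 (GRing.semilinear_linear phil)).
exists phi; split=> [|a b|a b|f].
- exact: scale1r.
- by apply/lfunP=> m; rewrite /= comp_lfunE !scale_lfunE !id_lfunE scalerA.
- move=> /lfunP ab; apply/eqP; rewrite -subr_eq0.
  have m0 : vpick {:M} != 0 by rewrite vpick0.
  have /eqP := ab (vpick {:M}).
  rewrite /= !scale_lfunE !id_lfunE -subr_eq0 -scalerBl scaler_eq0.
  by rewrite (negPf m0) orbF.
- split=> [/mem_homB/scal[a ->]|[a ->]]; first by exists a.
  by apply/mem_homB; apply: is_homZ; apply: is_hom_id.
Qed.

End ScalarEndomorphisms.

(** * Hom and Ext between extended modules *)

Section Transfer.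
Variables (K : fieldType) (A R : falgType K) (xi : split_ext R A).
Local Notation sec := (se_sec xi).
Local Notation E := (ext_bimod xi).
Local Notation Q := (ker_bimod xi).
Local Notation restr := (pull_rmod sec).
Local Notation pureR := (@pure _ _ _ _ E).
Implicit Types M N : rmod A.

(** Since Hom_A(M, N (x) Q) = 0, the restriction of F to M takes its values in
    the summand N of N (x) E. *)
Lemma hom_tensor M N : homB M (tensor N Q) = 0%VS ->
  forall F : 'Hom(tensor M E, tensor N E), is_hom F ->
  exists c : 'Hom(M, N),
    is_hom c /\ forall m (r : R), F (pureR m r) = pureR (c m) r.
Proof.
move=> /homB_eq0 H0 F FH.
pose f : 'Hom(M, restr (tensor N E)) := (F \o unit_map xi M)%VF.
have fH : is_hom f.
  by move=> m a; rewrite !comp_lfunE unit_map_hom; apply: FH.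
have tail0 : (tail_map xi N \o f)%VF = 0.
  by apply: H0; apply: is_hom_comp fH; apply: tail_map_hom.
exists (head_map xi N \o f)%VF; split.
  by apply: is_hom_comp fH; apply: head_map_hom.
move=> m r; rewrite pure_unit FH comp_lfunE [RHS]pure_unit; congr (ract _ r).
have tm0 : tail_map xi N (f m) = 0 by rewrite -comp_lfunE tail0 lfunE.
have -> : F (pureR m 1) = f m by rewrite comp_lfunE unit_mapE.
by rewrite {1}(tensor_split (f m)) tm0 linear0 addr0 unit_mapE.
Qed.

Lemma hom_tensor_eq0 M N : homB M N = 0%VS -> homB M (tensor N Q) = 0%VS ->
  homB (tensor M E) (tensor N E) = 0%VS.
Proof.
move=> /homB_eq0 MN0 MQ0; apply/homB_eq0 => F /(hom_tensor MQ0)[c [cH cE]].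
apply/lfunP; apply: tensor_hom_eq => m r.
by rewrite cE (MN0 _ cH) !lfunE /= (lin_0 (pure_linl (X := E) r)).
Qed.

(** By adjunction a cocycle on the extended resolution is a cocycle on P with
    values in (N (x) E)|A; both of its components bound. *)
Lemma ext_of_tensor_eq0 M N (P : projres M) n (pE : projective_ext xi) :
  ext_of N P n.+1 = 0%VS -> ext_of (tensor N Q) P n.+1 = 0%VS ->
  ext_of (tensor N E) (tensor_res pE P) n.+1 = 0%VS.
Proof.
move=> /ext_of_eq0 exN /ext_of_eq0 exQ; apply/ext_of_eq0 => F FH Fd.
pose f : 'Hom(P n.+1, restr (tensor N E)) := (F \o unit_map xi (P n.+1))%VF.
have fH : is_hom f by move=> m a; rewrite !comp_lfunE unit_map_hom; apply: FH.
have fd x : f (pr_d P n.+1 x) = 0.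
  by have := Fd (pureR x 1); rewrite tens_mapE comp_lfunE unit_mapE.
have hH := @head_map_hom _ _ _ xi N; have tH := @tail_map_hom _ _ _ xi N.
have iH := @tail_incl_hom _ _ _ xi N.
have [||g [gH gE]] := exN (head_map xi N \o f)%VF.
- exact: is_hom_comp fH.
- by move=> x; rewrite comp_lfunE fd linear0.
have [||k [kH kE]] := exQ (tail_map xi N \o f)%VF.
- exact: is_hom_comp fH.
- by move=> x; rewrite comp_lfunE fd linear0.
pose h : 'Hom(P n, restr (tensor N E)) :=
  ((unit_map xi N \o g) + (tail_incl xi N \o k))%VF.
have hhH : is_hom h.
  apply: is_homD; last exact: is_hom_comp.
  exact: is_hom_comp (@unit_map_hom _ _ _ _ _) gH.
have [G [GH GE]] := hom_extend hhH.
exists G; split=> // t; rewrite -[RHS]comp_lfunE; move: t.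
apply: tensor_hom_eq => m r.
rewrite comp_lfunE tens_mapE GE pure_unit FH; congr (ract _ r).
have -> : F (pureR m 1) = f m by rewrite comp_lfunE unit_mapE.
rewrite {1}(tensor_split (f m)) add_lfunE !comp_lfunE -gE -kE.
by rewrite !comp_lfunE.
Qed.

Lemma ext_tensor_eq0 M N n : projective_ext xi ->
  Ext n.+1 M N = 0%VS -> Ext n.+1 M (tensor N Q) = 0%VS ->
  Ext n.+1 (tensor M E) (tensor N E) = 0%VS.
Proof.
move=> pE exN exQ.
apply: (@ext_of_eq0_indep _ _ _ _ (tensor_res pE (std_res M))).
exact: ext_of_tensor_eq0.
Qed.

Lemma exceptional_tensor M : projective_ext xi -> exceptional M ->
  homB M (tensor M Q) = 0%VS ->
  (forall n, (0 < n)%N -> Ext n M (tensor M Q) = 0%VS) ->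
  exceptional (tensor M E).
Proof.
move=> pE [_ /end_iso_KP[M0 scal] exM] hQ exQ.
have T0 : ({:tensor M E} != 0)%VS.
  apply: contra_neq M0 => T0; apply/eqP; rewrite -subv0; apply/subvP=> m _.
  rewrite memv0 -(head_map_unit xi m).
  have : unit_map xi M m \in (fullv : {vspace tensor M E}) by exact: memvf.
  by rewrite T0 memv0 => /eqP->; rewrite linear0.
have Tscal (F : 'End(tensor M E)) : is_hom F -> exists a : K, F = a *: \1%VF.
  move=> /(hom_tensor hQ)[c [/scal[a ->] cE]]; exists a.
  apply/lfunP; apply: tensor_hom_eq => m r.
  by rewrite cE !scale_lfunE !id_lfunE (lin_Z (pure_linl (X := E) r)).
split.
- exact: indecomposable_of_scalar_end.
- exact/end_iso_KP.
- by case=> // n n0; apply: ext_tensor_eq0; [| apply: exM | apply: exQ].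
Qed.

End Transfer.

(** * The radical and maximal submodules *)

Section Nakayama.
Variables (K : fieldType) (B : falgType K) (X : rmod B).

Definition maximal_submodule (Y : {vspace X}) : Prop :=
  [/\ stable Y, Y <> fullv &
      forall Z : {vspace X}, stable Z -> (Y <= Z)%VS -> Z = Y \/ Z = fullv].

Lemma maximal_submodule_exists :
  ({:X} != 0)%VS -> exists Y, maximal_submodule Y.
Proof.
move=> X0.
pose P d :=
  `[< exists Y : {vspace X}, [/\ stable Y, Y <> fullv & \dim Y = d] >].
have exP : exists d, P d.
  exists 0%N; apply/asboolP; exists 0%VS; split; last exact: dimv0.
    by move=> u b; rewrite memv0 => /eqP->; rewrite (lin_0 (ract_linl b)) mem0v.
  by move=> /esym/eqP; apply/negP.
have ubP d : P d -> (d <= \dim {:X})%N.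
  by case/asboolP=> Y [_ _ <-]; apply: dimvS; apply: subvf.
case: (ex_maxnP exP ubP) => d /asboolP[Y [sY Yf Yd]] maxd.
exists Y; split=> // Z sZ YZ.
have [->|Zf] := pselect (Z = fullv); [by right | left].
apply/esym/eqP; rewrite eqEdim YZ Yd; apply: maxd.
by apply/asboolP; exists Z.
Qed.

(** If x is not in Y, the elements b with x b in Y form a right ideal, the
    annihilator of the class of x in the simple module X / Y.  It is maximal
    because the class of x generates X / Y, so it contains the radical. *)
Lemma radical_act_maximal (Y : {vspace X}) (q : B) : maximal_submodule Y ->
  in_jacobson_radical q -> forall x : X, ract x q \in Y.
Proof.
move=> [sY Yf Ymax] qrad x.
have [/sY //|xY] := boolP (x \in Y).
pose rx : 'Hom(B, X) := llinfun (ract_linr x).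
suff: maximal_right_ideal (rx @^-1: Y)%VS.
  by move=> /qrad; rewrite -memv_preim llinfunE.
split.
- by move=> a b; rewrite -!memv_preim !llinfunE ractM; apply: sY.
- move=> If; have := memvf (1 : B).
  by rewrite -If -memv_preim llinfunE ract1 (negPf xY).
move=> J rJ IJ.
have sZ : stable (Y + rx @: J)%VS.
  move=> _ b /memv_addP[y Yy [_ /memv_imgP[j Jj ->] ->]].
  rewrite -[X in ract (X + _)]scale1r ract_linl scale1r memv_add ?sY //.
  by apply/memv_imgP; exists (j * b); rewrite ?rJ // !llinfunE ractM.
have [ZY|Zf] := Ymax _ sZ (addvSl _ _).
  left; apply/eqP; rewrite eqEsubv IJ andbT; apply/subvP=> j Jj.
  rewrite -memv_preim -ZY; apply: (subvP (addvSr _ _)).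
  exact: memv_img.
right; apply/vspaceP=> b; rewrite memvf.
have /memv_addP[y Yy [_ /memv_imgP[j Jj ->] xE]] : x \in (Y + rx @: J)%VS.
  by rewrite Zf memvf.
suff J1 : 1 \in J by rewrite -[b]mul1r rJ.
rewrite -(subrK j 1) memvD //; apply: (subvP IJ).
rewrite -memv_preim linearB /= [rx 1]llinfunE ract1.
by rewrite {1}xE addrK.
Qed.

End Nakayama.

(** * Restriction of scalars on Grothendieck groups *)

Section PullGrothendieck.
Variables (K : fieldType).
Local Notation free B := {freeg {classic rvmod B} / int}.

(** The restriction of scalars of [pull_rmod], kept inside the generators of
    the Grothendieck group. *)
Definition pull_rv (A B : falgType K) (phi : {lrmorphism B -> A})
    (M : rvmod A) : rvmod B :=
  let P := pull_rmod phi (rv_rmod M) in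
  @RVMod K B (rv_dim M) (@ract _ _ P) (@ract_linl _ _ P) (@ract_linr _ _ P)
    (@ract1 _ _ P) (@ractM _ _ P).

Definition pull_free (A B : falgType K) (phi : {lrmorphism B -> A}) :
    free A -> free B :=
  fglift (fun M : {classic rvmod A} =>
            << (pull_rv phi M : {classic rvmod B}) >> : free B).

Fact pull_free_additive (A B : falgType K) (phi : {lrmorphism B -> A}) :
  zmod_morphism (pull_free phi).
Proof. exact: lift_is_additive. Qed.

HB.instance Definition _ (A B : falgType K) (phi : {lrmorphism B -> A}) :=
  GRing.isZmodMorphism.Build _ _ (pull_free phi) (pull_free_additive phi).

Lemma pull_freeU (A B : falgType K) (phi : {lrmorphism B -> A})
    (M : {classic rvmod A}) :
  pull_free phi << M >> = << (pull_rv phi M : {classic rvmod B}) >>.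
Proof. by rewrite /pull_free liftU scale1r. Qed.

(** Restriction of scalars does not change the underlying spaces and linear
    maps, hence it is exact. *)
Lemma pull_free_rel (A B : falgType K) (phi : {lrmorphism B -> A})
    (x : free A) :
  k0_rel x -> k0_rel (pull_free phi x).
Proof.
elim=> [|{}x y _ IHx _ IHy|L M N [f [g [fH gH f0 fg gS]]]].
- by rewrite raddf0; apply: k0_rel0.
- by rewrite raddfB; apply: k0_relB.
rewrite !raddfB /= !pull_freeU; apply: k0_rel_ses.
by exists f, g; split=> // m b; [apply: fH | apply: gH].
Qed.

Lemma rvmod_eq (B : falgType K) n (act act' : 'rV[K]_n -> B -> 'rV[K]_n)
    a1 a2 a3 a4 b1 b2 b3 b4 : act =2 act' ->
  @RVMod K B n act a1 a2 a3 a4 = @RVMod K B n act' b1 b2 b3 b4.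
Proof.
move=> E; have {}E : act = act' by apply/funext=> m; apply/funext=> b.
case: _ / E in b1 b2 b3 b4 *.
by congr RVMod; apply: Prop_irrelevance.
Qed.

Lemma rv_model (B : falgType K) (M : rmod B) :
  exists (N : rvmod B) (f : 'Hom(M, rv_rmod N)) (g : 'Hom(rv_rmod N, M)),
    [/\ is_hom f, is_hom g, cancel f g & cancel g f].
Proof.
have [N [f [fH f0 /surj_exP fS]]] := rv_rmod_iso M.
have fK : cancel f (f^-1)%VF by apply: lker0_lfunK; apply/eqP.
have gK : cancel (f^-1)%VF f by move=> y; have [x ->] := fS y; rewrite fK.
exists N, f, (f^-1)%VF; split=> // y b.
by have [x ->] := fS y; rewrite -fH !fK.
Qed.

Lemma k0_relD (B : falgType K) (x y : free B) :
  k0_rel x -> k0_rel y -> k0_rel (x + y).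
Proof.
move=> xr yr; rewrite -[y]opprK -(sub0r y).
by apply: k0_relB => //; apply: k0_relB => //; apply: k0_rel0.
Qed.

(** To induce the identity on the Grothendieck group, it suffices to fix the
    classes of the generators. *)
Lemma k0_rel_gen (B : falgType K) (F : {additive free B -> free B}) :
  (forall M : {classic rvmod B}, k0_rel (F << M >> - << M >>)) ->
  forall x, k0_rel (F x - x).
Proof.
move=> FM x; rewrite -(freeg_sumE x) raddf_sum -sumrB.
apply/asboolP; apply: (@rpred_sum _ (@k0_pred K B)) => M _.
rewrite -[coeff M x]intz -freegU_mulz raddfMz -mulrzBl.
by apply: rpredMz; apply/asboolP/FM.
Qed.

(** If G induces a left inverse of the map that F induces on Grothendieck
    groups, the latter is injective and preserves independence.  Both maps
    live on free groups: F is applied to representatives of the classes, and G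
    takes a relation between their images back to one between them. *)
Lemma zindep_K0 (A B : falgType K) (F : {additive free A -> free B})
    (G : {additive free B -> free A}) :
  (forall y, k0_rel y -> k0_rel (G y)) ->
  (forall x, k0_rel (G (F x) - x)) ->
  forall r, (exists x : 'I_r -> K0 A, zindep x) ->
  exists y : 'I_r -> K0 B, zindep y.
Proof.
move=> Grel GF r [x xi].
have pi0 (C : falgType K) (z : free C) :
    \pi_({ideal_quot @k0_pred K C}) z = 0 <-> k0_rel z.
  rewrite -(raddf0 \pi_({ideal_quot @k0_pred K C})).
  split=> [/eqP|zr].
    by rewrite -Quotient.idealrBE subr0 => /asboolP.
  by apply/eqP; rewrite -Quotient.idealrBE subr0; apply/asboolP.
pose z i : free A := repr (x i : {ideal_quot @k0_pred K A}).
pose y i : K0 B := \pi_({ideal_quot @k0_pred K B}) (F (z i)).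
exists y => c yc0; apply: xi.
have : k0_rel (F (\sum_i z i *~ c i)).
  apply/pi0; rewrite -[RHS]yc0 !raddf_sum; apply: eq_bigr => i _.
  by rewrite /y !raddfMz.
move/Grel => GFr.
have : k0_rel (\sum_i z i *~ c i).
  rewrite -[X in k0_rel X](subKr (G (F (\sum_i z i *~ c i)))).
  by apply: k0_relB.
move/pi0 => z0; rewrite -[RHS]z0 raddf_sum; apply: eq_bigr => i _.
by rewrite raddfMz; congr (_ *~ _); apply/esym/reprK.
Qed.

End PullGrothendieck.

(** * The ranks of the two Grothendieck groups *)

Section Rank.
Variables (K : fieldType) (A R : falgType K) (xi : split_ext R A).
Local Notation sec := (se_sec xi).
Local Notation free B := {freeg {classic rvmod B} / int}.
Local Notation twist := (fun X : rvmod R => pull_rv xi (pull_rv sec X)).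

Lemma pull_sec_xi (M : rvmod A) : pull_rv sec (pull_rv xi M) = M.
Proof. by case: M => n act *; apply: rvmod_eq => m a /=; rewrite se_secK. Qed.

Lemma twist_id (X : rvmod R) :
  (forall (m : rv_rmod X) q, xi q = 0 -> ract m q = 0) -> twist X = X.
Proof.
move=> XQ; suff : @rv_act _ _ (twist X) =2 @rv_act _ _ X.
  by case: X {XQ} => n act ? ? ? ? E; apply: rvmod_eq.
move=> m b; apply/eqP; rewrite -subr_eq0; apply/eqP.
rewrite -(lin_B (@ract_linr _ _ (rv_rmod X) m)); apply: XQ.
by rewrite linearB /= se_secK subrr.
Qed.

(** Induction on dim X along 0 -> Y -> X -> X / Y -> 0 with Y maximal: the
    twist does not change X / Y, on which the kernel of xi acts by zero. *)
Lemma twist_rel (X : rvmod R) :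
  k0_rel (<< (twist X : {classic rvmod R}) >>
          - << (X : {classic rvmod R}) >> : free R).
Proof.
have [n] := ubnP (\dim {: rv_rmod X}); elim: n X => // n IH X.
rewrite ltnS => Xn.
have [X0|X0] := eqVneq {: rv_rmod X}%VS 0%VS.
  rewrite twist_id ?subrr; first exact: k0_rel0.
  by move=> m q _; apply/eqP; rewrite -memv0 -X0 memvf.
have [Y Ymax] := maximal_submodule_exists X0.
have [sY Yf _] := Ymax.
have [Y' [fY [gY [fYH gYH fYK gYK]]]] := rv_model (sub_rmod sY).
have [W' [fW [gW [fWH gWH fWK gWK]]]] := rv_model (quot_rmod sY).
have W'Q (m : rv_rmod W') q : xi q = 0 -> ract m q = 0.
  move=> /se_rad q0; rewrite -(gWK m) -fWH.
  suff -> : ract (gW m) q = 0 by rewrite linear0.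
  by apply/eqP; rewrite /= quot_proj_eq0 (radical_act_maximal Ymax).
have YX : ses (rv_rmod Y') (rv_rmod X) (rv_rmod W').
  have [i [p [iH pH i0 ip pS]]] := sub_quot_ses sY.
  exists (i \o gY)%VF, (fW \o p)%VF; split.
  - exact: is_hom_comp.
  - exact: is_hom_comp.
  - apply/eqP/lker0P=> u v; rewrite !comp_lfunE => /(lker0P (introT eqP i0)).
    exact: (can_inj gYK).
  - apply/vspaceP=> x; rewrite memv_ker comp_lfunE.
    rewrite -[X in _ == X](linear0 fW) (inj_eq (can_inj fWK)) -memv_ker -ip.
    apply/idP/idP=> /limg_exP[u ->]; apply/limg_exP.
      by exists (gY u); rewrite comp_lfunE.
    by exists (fY u); rewrite comp_lfunE fYK.
  - apply/surj_exP=> w; have /surj_exP/(_ (gW w))[x xE] := pS.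
    by exists x; rewrite comp_lfunE -xE gWK.
have dY : (\dim {: rv_rmod Y'} < n)%N.
  pose j := (sub_incl sY \o gY)%VF.
  have j0 : lker j = 0%VS.
    apply/eqP/lker0P=> u v; rewrite !comp_lfunE !sub_inclE => /vsval_inj.
    exact: (can_inj gYK).
  rewrite -(limg_dim_eq (f := j)) ?j0 ?capv0 //.
  apply: leq_trans Xn; apply: (@leq_ltn_trans (\dim Y)).
    apply: dimvS; apply/subvP=> _ /limg_exP[u ->].
    by rewrite comp_lfunE sub_inclE subvsP.
  rewrite ltnNge; apply/negP => leY; apply: Yf; apply/eqP.
  by rewrite eqEdim subvf.
have relX := k0_rel_ses (YX : ses (rv_rmod (Y' : {classic rvmod R}))
  (rv_rmod (X : {classic rvmod R})) (rv_rmod (W' : {classic rvmod R}))).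
have := pull_free_rel xi (pull_free_rel sec relX).
rewrite !raddfB /= !pull_freeU (twist_id W'Q) => relT.
have := k0_relD (k0_relB relT relX) (IH _ dY).
have telescope (V : zmodType) (a b c d e : V) :
    a - b - c - (d - e - c) + (b - e) = a - d.
  rewrite opprB (addrA (a - b - c)) subrK opprB -addrA [e - d + _]addrC.
  by rewrite !addrA !subrK.
by rewrite telescope.
Qed.

Lemma has_rank_K0 r : has_rank (K0 A) r -> has_rank (K0 R) r.
Proof.
move=> [indA dimA]; split.
  apply: (@zindep_K0 _ _ _ (pull_free xi) (pull_free sec)) indA.
    exact: pull_free_rel.
  move=> x; apply: (@k0_rel_gen _ _ (pull_free sec \o pull_free xi)) => M.
  by rewrite /= !pull_freeU pull_sec_xi subrr; apply: k0_rel0.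
move=> indR; apply: dimA.
apply: (@zindep_K0 _ _ _ (pull_free sec) (pull_free xi)) indR.
  exact: pull_free_rel.
move=> x; apply: (@k0_rel_gen _ _ (pull_free xi \o pull_free sec)) => M.
by rewrite /= !pull_freeU; apply: twist_rel.
Qed.

End Rank.

(** * Exceptional sequences under split extensions *)

Theorem theorem3p5 (K : closedFieldType) (A R : falgType K)
    (xi : split_ext R A) (r : nat) (M : 'I_r -> rmod A)
    (h1 : exceptional_seq M)
    (h2 : projective_ext xi)
    (h3 : (forall k : 'I_r,
             homB (M k) (tensor (M k) (ker_bimod xi)) = 0%VS) /\
          (forall i j : 'I_r, (i < j)%N ->
             homB (M j) (tensor (M i) (ker_bimod xi)) = 0%VS))
    (h4 : (forall (n : nat) (k : 'I_r), (0 < n)%N ->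
             Ext n (M k) (tensor (M k) (ker_bimod xi)) = 0%VS) /\
          (forall (n : nat) (i j : 'I_r), (0 < n)%N -> (i < j)%N ->
             Ext n (M j) (tensor (M i) (ker_bimod xi)) = 0%VS)) :
  exceptional_seq (fun k => tensor (M k) (ext_bimod xi)) /\
  (complete_exceptional_seq M ->
   complete_exceptional_seq (fun k => tensor (M k) (ext_bimod xi))).

Proof.
have [exM pairM] := h1; have [homQ homQ2] := h3; have [extQ extQ2] := h4.
have exT k : exceptional (tensor (M k) (ext_bimod xi)).
  by apply: exceptional_tensor => // n n0; apply: extQ.
have seqT : exceptional_seq (fun k => tensor (M k) (ext_bimod xi)).
  split=> // i j ij; have [_ _ homM extM] := pairM i j ij.
  split=> //; first by apply: hom_tensor_eq0; [| apply: homQ2].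
  by case=> // n n0; apply: ext_tensor_eq0; [| apply: extM | apply: extQ2].
by split=> // -[_ rkA]; split=> //; apply: has_rank_K0 rkA.
Qed.
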